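(* For the cost function $$U\left(\sum_{i=1}^n r_i\right)=\frac12\left\|d+\sum_{i=1}^n r_i/m\right\|^2$$ with $d\in\mathbb{R}^T$ and $n/m=\gamma$ for a fixed constant $\gamma$, the expected suboptimality of the differentially private distributed projected gradient descent algorithm described in the context, applied to the EV charging problem, is bounded as $$\mathbb{E}\left[U\left(\sum_{i=1}^n\hat r_i^{(K+1)}\right)-U^*\right]\le\mathcal{O}\left(\eta\,T^{1/4}\left(\frac{\Delta}{n\epsilon}\right)^{1/4}\right),$$ where $U^*$ is the optimal value of the problem of minimizing $U(\sum_{i=1}^n r_i)$ subject to $r_i\in\mathcal{C}_i$, $i\in[n]$.
   Context: $\|\cdot\|$ is the $\ell_2$-norm, $\|\cdot\|_1$ the $\ell_1$-norm, $[n]=\{1,\dots,n\}$, $\mathbf{1}$ is the all-ones vector, $\preceq$ is componentwise inequality, and $\Pi_{\mathcal{C}}$ is the $\ell_2$-projection onto $\mathcal{C}$. EV charging problem: minimize $U(\sum_i r_i)$ over $r_1,\dots,r_n\in\mathbb{R}^T$ subject to $r_i\in\mathcal{C}_i=\mathcal{C}(\bar r_i,E_i):=\{x\in\mathbb{R}^T\colon 0\preceq x\preceq\bar r_i,\ \mathbf{1}^Tx=E_i\}$, where $\mathbf{1}^T\bar r_i\ge E_i$, $E_i>0$, $\bar r_i\succeq 0$. The constant $L$ is the Lipschitz constant $1/m^2$ with $\nabla U(\sum_i r_i)$ denoting $\frac1m(d+\sum_i r_i/m)$, the gradient of the function $x\mapsto\frac12\|d+x/m\|^2$ at $x=\sum_i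 r_i$. For given $\delta r,\delta E\ge0$, $$\Delta:=\max_{i\in[n]}\max\{\|\Pi_{\mathcal{C}(\bar r_i,E_i)}(r)-\Pi_{\mathcal{C}(\bar r_i',E_i')}(r)\|\colon r\in\mathbb{R}^T,\ \|\bar r_i-\bar r_i'\|_1\le\delta r,\ |E_i-E_i'|\le\delta E\},$$ assumed positive, and $\epsilon>0$ is the privacy level. Algorithm (parameters $K$, $\{\alpha_k\}_{k=1}^K$, $\eta\ge1$, $\Delta$, $\epsilon$): initialize $\{r_i^{(1)}\}_{i=1}^n$ arbitrarily, let $\hat r_i^{(1)}=r_i^{(1)}$ and $\theta_k=(\eta+1)/(\eta+k)$. For $k=1,\dots,K$: (1) if $k=1$ set $w_1=0$; otherwise draw $w_k\in\mathbb{R}^T$ (independently of everything before) from the probability density proportional to $\exp\left(-\frac{2\epsilon\|w_k\|}{K(K-1)L\Delta}\right)$; (2) compute $\hat p^{(k)}:=\nabla U(\sum_{i=1}^n r_i^{(k)})+w_k$; (3) for $i\in[n]$ compute $r_i^{(k+1)}:=\Pi_{\mathcal{C}_i}(r_i^{(k)}-\alpha_k\hat p^{(k)})$ and $\hat r_i^{(k+1)}:=(1-\theta_k)\hat r_i^{(k)}+\theta_k r_i^{(k+1)}$. The output is $\{\hat r_i^{(K+1)}\}_{i=1}^n$. Parameter choices: with $\rho=\max\{\sqrt{\sum_i\|r_i\|^2}\colon r_i\in\mathcal{C}_i\}$ and $G=\max\{\|\nabla U(\sum_i r_i)\|\colon r_i\in\mathcal{C}_i\}$, the number of iterations is $K=(\sqrt2\,G\epsilon/(3TL\Delta))^{1/2}$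 (treated as an admissible number of iterations) and $\alpha_k=c/\sqrt k$ with $c=\rho/\widehat G$, $\widehat G=\sqrt n(G+\sqrt2\,TK^2L\Delta/(2\epsilon))$. The $\mathcal{O}(\cdot)$ hides a constant depending only on $\|d\|$, $\gamma$ and $r_{\max}=\max_{i\in[n]}\max_{r_i\in\mathcal{C}_i}\|r_i\|$. *)

(* Defs.v *)
From HB Require Import structures.
From mathcomp Require Import all_boot all_order all_algebra.
From mathcomp Require Import all_classical all_reals all_analysis.

Set Implicit Arguments.
Unset Strict Implicit.
Unset Printing Implicit Defensive.

Import Order.TTheory GRing.Theory Num.Theory.
Import numFieldNormedType.Exports.

Local Open Scope classical_set_scope.
Local Open Scope ring_scope.

Section ChargingProblem.
Context {R : realType} {T : nat}.
Implicit Types (x d : 'rV[R]_T) (C : set 'rV[R]_T).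

(* The library norm on 'rV[R]_T is the sup norm, hence the explicit l2-norm. *)
Definition norm2 x : R := Num.sqrt (\sum_t x 0 t ^+ 2).

Definition norm1 x : R := \sum_t `|x 0 t|.

(* A minimizer of the l2-distance to C; it is unique when C is nonempty, closed
   and convex, and 0 is a dummy value for C without minimizer. *)
Definition proj C x : 'rV[R]_T :=
  xget 0 [set y | C y /\ forall z, C z -> norm2 (x - y) <= norm2 (x - z)].

Definition charging_set (rbar : 'rV[R]_T) (E : R) : set 'rV[R]_T :=
  [set x | (forall t, 0 <= x 0 t <= rbar 0 t) /\ \sum_t x 0 t = E].

Definition admissible (rbar : 'rV[R]_T) (E : R) : Prop :=
  [/\ forall t, 0 <= rbar 0 t, 0 < E & E <= \sum_t rbar 0 t].

Definition costU (m : R) d x : R := 2^-1 * norm2 (d + m^-1 *: x) ^+ 2.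

Definition gradU (m : R) d x : 'rV[R]_T := m^-1 *: (d + m^-1 *: x).

Lemma gradUP (m : R) d x v :
  is_derive x v (costU m d : 'rV[R]_T -> R) (\sum_t gradU m d x 0 t * v 0 t).
Proof.
have Dg t : is_derive x v (fun y : 'rV[R]_T => d 0 t + m^-1 * y 0 t : R)
                          (m^-1 * v 0 t).
  have cvg_quot : (h^-1 *: (((fun y : 'rV[R]_T => d 0 t + m^-1 * y 0 t : R)
      \o shift x) (h *: v) - (d 0 t + m^-1 * x 0 t)) @[h --> (0 : R)^'])
      --> m^-1 * v 0 t.
    apply: cvg_near_cst; near=> h.
    have h0 : h != 0 by near: h; exact: nbhs_dnbhs_neq.
    rewrite /= !mxE mulrDr opprD addrACA subrr add0r addrK.
    by rewrite mulrCA -[_ *: _]/(h^-1 * _) mulKf.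
  apply: DeriveDef; first by apply/cvg_ex; eexists; exact: cvg_quot.
  exact: cvg_lim cvg_quot.
have -> : (costU m d : 'rV[R]_T -> R)
    = 2^-1 \*: \sum_t (fun y : 'rV[R]_T => d 0 t + m^-1 * y 0 t : R) ^+ 2.
  apply/funext => y; rewrite /costU /norm2 sqr_sqrtr; last first.
    by apply: sumr_ge0 => t _; exact: sqr_ge0.
  rewrite /= fct_sumE; congr (_ * _); apply: eq_bigr => t _.
  by rewrite !mxE.
apply: is_derive_eq.
rewrite scaler_sumr; apply: eq_bigr => t _.
rewrite /GRing.scale /= expr1 !mxE.
by rewrite -[2 * _ * _]mulrA mulKf ?pnatr_eq0// mulrCA mulrA.
Unshelve. all: by end_near.
Qed.

Definition lipL (m : R) : R := (m ^+ 2)^-1.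

Section Users.
Context {n : nat} (rbar : 'I_n -> 'rV[R]_T) (E : 'I_n -> R).
Implicit Types (r : 'I_n -> 'rV[R]_T).

Definition feasible : set ('I_n -> 'rV[R]_T) :=
  [set r | forall i, charging_set (rbar i) (E i) (r i)].

(* The extrema below are over nonempty bounded sets (compact ones, except for
   Delta), so that inf and sup are the min and max whenever these exist. *)
Definition Ustar (m : R) d : R :=
  inf [set costU m d (\sum_i r i) | r in feasible].

Definition rho : R :=
  sup [set Num.sqrt (\sum_i norm2 (r i) ^+ 2) | r in feasible].

Definition Gmax (m : R) d : R :=
  sup [set norm2 (gradU m d (\sum_i r i)) | r in feasible].

Definition rmax : R :=
  \big[Num.max/0]_i sup [set norm2 x | x in charging_set (rbar i) (E i)].

Definition Delta (dr dE : R) : R :=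
  \big[Num.max/0]_i
    sup [set a | exists (x rbar' : 'rV[R]_T) (E' : R),
      [/\ admissible rbar' E', norm1 (rbar i - rbar') <= dr,
          `|E i - E'| <= dE &
          a = norm2 (proj (charging_set (rbar i) (E i)) x
                     - proj (charging_set rbar' E') x)]].

Definition Ghat (m : R) d (dr dE eps : R) (K : nat) : R :=
  Num.sqrt n%:R * (Gmax m d
    + Num.sqrt 2 * T%:R * K%:R ^+ 2 * lipL m * Delta dr dE / (2 * eps)).

Definition stepsize (m : R) d (dr dE eps : R) (K k : nat) : R :=
  rho / Ghat m d dr dE eps K / Num.sqrt k%:R.

Definition theta (eta : R) (k : nat) : R := (eta + 1) / (eta + k%:R).

(* [dpgd j] is the pair (r^(j+1), rhat^(j+1)) reached after rounds 1, ..., j;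
   round 1 uses no noise, and [w k] is the noise of round k >= 2. *)
Fixpoint dpgd (m : R) d (eta : R) (alpha : nat -> R) (w : nat -> 'rV[R]_T)
    (r1 : 'I_n -> 'rV[R]_T) (j : nat) :
    ('I_n -> 'rV[R]_T) * ('I_n -> 'rV[R]_T) :=
  match j with
  | 0 => (r1, r1)
  | k'.+1 =>
    let: (r, rhat) := dpgd m d eta alpha w r1 k' in
    let k := k'.+1 in
    let phat := gradU m d (\sum_i r i) + (if k == 1%N then 0 else w k) in
    let r' := fun i => proj (charging_set (rbar i) (E i))
                            (r i - alpha k *: phat) in
    (r', fun i => (1 - theta eta k) *: rhat i + theta eta k *: r' i)
  end.

Definition dpgd_output (m : R) d (eta : R) (alpha : nat -> R)
    (w : nat -> 'rV[R]_T) (r1 : 'I_n -> 'rV[R]_T) (K : nat) :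
    'I_n -> 'rV[R]_T :=
  (dpgd m d eta alpha w r1 K).2.

End Users.
End ChargingProblem.

Section Noise.
Context {R : realType}.

(* Random vectors take values in T.-tuple R, which carries the product
   (= Borel) sigma-algebra; the library has none on 'rV[R]_T. *)
Definition row_of_tuple T (v : T.-tuple R) : 'rV[R]_T := \row_t tnth v t.

(* Integral over R^T with respect to the Lebesgue measure, as an iterated
   integral; only used on nonnegative measurable functions (Tonelli). *)
Fixpoint lebesgue_tuple_int (T : nat) : (T.-tuple R -> \bar R) -> \bar R :=
  match T return (T.-tuple R -> \bar R) -> \bar R with
  | 0 => fun f => f [tuple]
  | T'.+1 => fun f =>
      (\int[@lebesgue_measure R]_x
        lebesgue_tuple_int (fun v : T'.-tuple R => f [tuple of x :: v]))%E
  end.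

Context {disp : measure_display} {Omega : measurableType disp}.
Variable P : probability Omega R.

Definition has_density_prop_to T (X : {RV P >-> T.-tuple R})
    (f : T.-tuple R -> R) : Prop :=
  exists2 c : R, 0 < c &
    forall B : set (T.-tuple R), measurable B ->
      P (X @^-1` B)
      = (c%:E * lebesgue_tuple_int (fun v => (\1_B v * f v)%:E))%E.

Definition mutually_independent T (I : set nat)
    (X : nat -> {RV P >-> T.-tuple R}) : Prop :=
  forall (J : seq nat) (B : nat -> set (T.-tuple R)),
    uniq J -> [set` J] `<=` I -> (forall k, measurable (B k)) ->
    P (\bigcap_(k in [set` J]) (X k @^-1` B k))
    = (\prod_(k <- J) fine (P (X k @^-1` B k)))%:E.

Definition privacy_noise T (m eps Delta : R) (K : nat)
    (w : nat -> {RV P >-> T.-tuple R}) : Prop :=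
  mutually_independent [set k | (2 <= k <= K)%N] w /\
  forall k, (2 <= k <= K)%N ->
    has_density_prop_to (w k) (fun v =>
      expR (- (2 * eps * norm2 (row_of_tuple v)
               / (K%:R * (K%:R - 1) * lipL m * Delta)))).

End Noise.

(* Main.v *)
Require Import Defs.
From HB Require Import structures.
From mathcomp Require Import all_boot all_order all_algebra.
From mathcomp Require Import all_classical all_reals all_analysis.
From mathcomp Require Import measurable_realfun.
From mathcomp Require Import ring lra.

(** The algorithm is projected stochastic gradient descent on the convex
    quadratic cost, with an averaging of the iterates that favours the late ones.

    Along one realization of the noise, a projection does not increase the
    distance to a feasible comparator u, so round [k.+1] pays for the regret of
    the iterate it starts from: a telescoping difference of squared distances, a
    second-order term proportional to the squared norm of the noisy gradient,
    and the inner product of the noise with the distance to u. The averaging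
    recursion of the output applies to these quantities as well. Its weights
    increase, so the distances telescope up to the last coefficient times the
    squared diameter [4 * rho ^ 2] ([weighted_descent], [pathwise_regret]), and
    averaging terms of size [B / sqrt k] gives at most [2 * B / sqrt K]
    ([decay_avg_le]). Accounting starts after round 1, when the iterate is
    feasible whatever the initial point was.

    In expectation the inner products vanish: the noise is independent of the
    past and symmetric, so changing the sign of one noise preserves the joint
    law ([noise_orthogonal]). This needs the iterates to be measurable functions
    of the noises, which holds because projections are 1-Lipschitz
    ([measurable_proj]). The second moment of the noise with density
    proportional to [exp (- lam * norm2 w)] is of order [T ^ 2 / lam ^ 2]; this
    follows from the scaling of the Lebesgue integral
    ([exponential_noise_second_moment]).

    The number of rounds K is chosen so that the noise is of the size of the
    gradient bound G ([noise_second_moment_le_G]). With the step sizes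
    [c / sqrt k] the suboptimality is at most [11 * eta * n * rmax * G / sqrt K]
    ([expected_suboptimality], [suboptimality_rate]). Since [K ^ 2] is
    proportional to [G * eps * m ^ 2 / (T * Delta)] and
    [G <= (norm2 d + gamma * rmax) / m], this is of the order of the fourth root
    of [T * Delta / (n * eps)] ([rate_fourth_root]). *)

Set Implicit Arguments.
Unset Strict Implicit.
Unset Printing Implicit Defensive.

Import Order.TTheory GRing.Theory Num.Theory.
Import numFieldNormedType.Exports.

Local Open Scope classical_set_scope.
Local Open Scope ring_scope.

(** * Euclidean geometry and projections on convex sets *)

Section EuclideanGeometry.
Context {R : realType} {T : nat}.
Implicit Types (x y z p q : 'rV[R]_T) (C : set 'rV[R]_T).

Definition dot x y : R := \sum_t x 0 t * y 0 t.

Lemma dotC x y : dot x y = dot y x.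
Proof. by apply: eq_bigr => t _; rewrite mulrC. Qed.

Lemma dotDl x y z : dot (x + y) z = dot x z + dot y z.
Proof. by rewrite -big_split; apply: eq_bigr => t _; rewrite /= mxE mulrDl. Qed.

Lemma dotZl a x y : dot (a *: x) y = a * dot x y.
Proof. by rewrite /dot mulr_sumr; apply: eq_bigr => t _; rewrite mxE mulrA. Qed.

Lemma dotNl x y : dot (- x) y = - dot x y.
Proof. by rewrite -scaleN1r dotZl mulN1r. Qed.

Lemma dotBl x y z : dot (x - y) z = dot x z - dot y z.
Proof. by rewrite dotDl dotNl. Qed.

Lemma dotDr x y z : dot z (x + y) = dot z x + dot z y.
Proof. by rewrite ![dot z _]dotC dotDl. Qed.

Lemma dotZr a x y : dot y (a *: x) = a * dot y x.
Proof. by rewrite ![dot y _]dotC dotZl. Qed.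

Lemma dotNr x y : dot y (- x) = - dot y x.
Proof. by rewrite ![dot y _]dotC dotNl. Qed.

Lemma dotBr x y z : dot z (x - y) = dot z x - dot z y.
Proof. by rewrite dotDr dotNr. Qed.

Lemma dot0l x : dot 0 x = 0.
Proof. by rewrite -(scale0r (0 : 'rV[R]_T)) dotZl mul0r. Qed.

Lemma dot_sumr (I : finType) (F : I -> 'rV[R]_T) x :
  dot x (\sum_i F i) = \sum_i dot x (F i).
Proof.
apply: (big_morph (dot x)); first by move=> a b; rewrite dotDr.
by rewrite dotC dot0l.
Qed.

Lemma dot_ge0 x : 0 <= dot x x.
Proof. by apply: sumr_ge0 => t _; rewrite -expr2 sqr_ge0. Qed.

Lemma norm2_ge0 x : 0 <= norm2 x.
Proof. exact: sqrtr_ge0. Qed.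

Lemma norm2_sq x : norm2 x ^+ 2 = dot x x.
Proof.
rewrite /norm2 sqr_sqrtr; first by apply: eq_bigr => t _; rewrite expr2.
by apply: sumr_ge0 => t _; rewrite sqr_ge0.
Qed.

Lemma norm2N x : norm2 (- x) = norm2 x.
Proof.
by apply: (@pexpIrn _ 2); rewrite ?nnegrE ?norm2_ge0// !norm2_sq dotNl dotNr opprK.
Qed.

Lemma norm2Z a x : norm2 (a *: x) = `|a| * norm2 x.
Proof.
apply: (@pexpIrn _ 2); rewrite ?nnegrE ?mulr_ge0 ?norm2_ge0//.
by rewrite exprMn !norm2_sq dotZl dotZr real_normK ?num_real//; ring.
Qed.

Lemma norm20 : norm2 (0 : 'rV[R]_T) = 0.
Proof. by rewrite -(scale0r (0 : 'rV[R]_T)) norm2Z normr0 mul0r. Qed.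

Lemma dot_le_norm2 x y : dot x y <= norm2 x * norm2 y.
Proof.
have [x0|x0] := eqVneq (norm2 x) 0; last have [y0|y0] := eqVneq (norm2 y) 0.
- have := norm2_sq x; rewrite x0 mul0r expr0n/= => /esym/eqP.
  rewrite psumr_eq0 => [/allP h|t _]; last by rewrite -expr2 sqr_ge0.
  rewrite /dot big1// => t _; have := h t (mem_index_enum t).
  by rewrite /= mulf_eq0 orbb => /eqP ->; rewrite mul0r.
- have := norm2_sq y; rewrite y0 mulr0 expr0n/= => /esym/eqP.
  rewrite psumr_eq0 => [/allP h|t _]; last by rewrite -expr2 sqr_ge0.
  rewrite /dot big1// => t _; have := h t (mem_index_enum t).
  by rewrite /= mulf_eq0 orbb => /eqP ->; rewrite mulr0.
have xp : 0 < norm2 x by rewrite lt_neqAle eq_sym x0 norm2_ge0.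
have yp : 0 < norm2 y by rewrite lt_neqAle eq_sym y0 norm2_ge0.
have := dot_ge0 (norm2 y *: x - norm2 x *: y).
rewrite dotBl !dotBr !dotZl !dotZr -!norm2_sq [dot y x]dotC => h.
have : 0 <= 2 * (norm2 x * norm2 y) * (norm2 x * norm2 y - dot x y) by lra.
by rewrite pmulr_rge0 ?subr_ge0// mulr_gt0// mulr_gt0.
Qed.

Lemma normr_dot_le x y : `|dot x y| <= norm2 x * norm2 y.
Proof.
rewrite ler_norml dot_le_norm2 andbT lerNl -dotNl.
by rewrite (le_trans (dot_le_norm2 _ _))// norm2N.
Qed.

Lemma norm2D x y : norm2 (x + y) <= norm2 x + norm2 y.
Proof.
rewrite -(ler_pXn2r (n := 2))// ?nnegrE ?addr_ge0 ?norm2_ge0//.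
rewrite sqrrD !norm2_sq dotDl !dotDr [dot y x]dotC.
have := dot_le_norm2 x y; lra.
Qed.

Lemma norm2D_sq_le x y : norm2 (x + y) ^+ 2 <= 2 * (norm2 x ^+ 2 + norm2 y ^+ 2).
Proof.
rewrite !norm2_sq; have := dot_ge0 (x - y).
rewrite dotBl !dotBr dotDl !dotDr [dot y x]dotC; lra.
Qed.

Lemma coord_le_norm2 x t : `|x 0 t| <= norm2 x.
Proof.
rewrite -sqrtr_sqr ler_wsqrtr// (bigD1 t)//= lerDl.
by apply: sumr_ge0 => i _; rewrite sqr_ge0.
Qed.

Lemma norm2_le_sum x : norm2 x <= \sum_t `|x 0 t|.
Proof.
rewrite -(ler_pXn2r (n := 2))// ?nnegrE ?norm2_ge0 ?sumr_ge0//.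
rewrite norm2_sq expr2 mulr_suml; apply: ler_sum => t _.
rewrite (le_trans (ler_norm _))// normrM ler_wpM2l// (bigD1 t)//= lerDl.
exact: sumr_ge0.
Qed.

Definition is_convex C := forall y z (a : R), C y -> C z -> 0 <= a <= 1 ->
  C ((1 - a) *: y + a *: z).

Definition nearest C x p := C p /\ forall z, C z -> norm2 (x - p) <= norm2 (x - z).

(** Moving from p towards z inside C cannot get closer to x, so the derivative at
    p of the squared distance to x in the direction z - p is nonnegative. *)
Lemma nearest_obtuse C x p z : is_convex C -> nearest C x p -> C z ->
  dot (x - p) (z - p) <= 0.
Proof.
move=> cC [Cp pmin] Cz; rewrite leNgt; apply/negP => d0.
set b := dot (z - p) (z - p); have b0 : 0 <= b by exact: dot_ge0.
set e := dot (x - p) (z - p) in d0 *.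
(* A step so small that its second-order cost a * b stays below its gain e. *)
pose a := Num.min 1 (e / (b + 1)).
have b1 : 0 < b + 1 by lra.
have a0 : 0 < a by rewrite lt_min ltr01 divr_gt0.
have a1 : a <= 1 by rewrite ge_min lexx.
have ab : a * b <= e.
  have : a * (b + 1) <= e by rewrite -ler_pdivlMr// ge_min lexx orbT.
  have := ltW a0; lra.
have := pmin _ (cC _ _ a Cp Cz _); rewrite (ltW a0) a1 => /(_ erefl).
rewrite -(ler_pXn2r (n := 2))// ?nnegrE ?norm2_ge0// !norm2_sq.
have -> : x - ((1 - a) *: p + a *: z) = (x - p) - a *: (z - p).
  by apply/rowP => t; rewrite !mxE; ring.
have -> : dot (x - p - a *: (z - p)) (x - p - a *: (z - p)) =
    dot (x - p) (x - p) - 2 * a * e + a ^+ 2 * b.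
  rewrite /e /b; move: (x - p) (z - p) => v s.
  by rewrite dotBl !dotBr !dotZl !dotZr (dotC s v); ring.
move=> h.
have : 0 <= a * (a * b - 2 * e) by lra.
rewrite pmulr_rge0//; lra.
Qed.

(** By obtuseness, x - p and p - u have a nonnegative inner product. *)
Lemma nearest_contract C x p u : is_convex C -> nearest C x p -> C u ->
  norm2 (p - u) ^+ 2 <= norm2 (x - u) ^+ 2.
Proof.
move=> cC np Cu; have := nearest_obtuse cC np Cu; rewrite !norm2_sq.
have -> : x - u = (x - p) + (p - u) by rewrite addrA subrK.
rewrite -(opprB p u) dotNr; move: (x - p) (p - u) => v s.
by have := dot_ge0 v; rewrite dotDl !dotDr (dotC s v); lra.
Qed.

(** Add the obtuse-angle inequalities of p towards q and of q towards p. *)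
Lemma nearest_nonexpansive C x y p q : is_convex C ->
  nearest C x p -> nearest C y q -> norm2 (p - q) <= norm2 (x - y).
Proof.
move=> cC np nq.
have h1 := nearest_obtuse cC np nq.1; have h2 := nearest_obtuse cC nq np.1.
rewrite -(ler_pXn2r (n := 2))// ?nnegrE ?norm2_ge0// !norm2_sq.
have -> : x - y = (x - p) + (p - q) - (y - q).
  by apply/rowP => t; rewrite !mxE; ring.
move: h1 h2; rewrite -(opprB p q) dotNr; move: (x - p) (y - q) (p - q) => v s r.
have := dot_ge0 (v - s); rewrite !(dotBl, dotBr, dotDl, dotDr).
by rewrite (dotC s v) (dotC r v) (dotC r s); lra.
Qed.

End EuclideanGeometry.

(** * Projections on charging sets *)

Section ChargingSet.
Context {R : realType} {T : nat} (rb : 'rV[R]_T) (E : R).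

Lemma charging_set_convex : is_convex (charging_set rb E).
Proof.
move=> y z a [y1 y2] [z1 z2] /andP[a0 a1]; split => [t|].
  have /andP[? ?] := y1 t; have /andP[? ?] := z1 t; rewrite !mxE.
  have ? : 0 <= 1 - a by lra.
  apply/andP; split; first by rewrite addr_ge0// mulr_ge0.
  have -> : rb 0 t = (1 - a) * rb 0 t + a * rb 0 t by ring.
  by rewrite lerD// ler_wpM2l.
under eq_bigr do rewrite !mxE.
by rewrite big_split/= -!mulr_sumr y2 z2; ring.
Qed.

(** Scaling the upper bound rb down to total E gives a feasible profile. *)
Lemma charging_set_nonempty : admissible rb E -> charging_set rb E !=set0.
Proof.
move=> [rb0 E0 Eb]; set S := \sum_t rb 0 t in Eb.
have S0 : 0 < S by exact: lt_le_trans Eb.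
exists ((E / S) *: rb); split => [t|]; last first.
  by under eq_bigr do rewrite mxE; rewrite -mulr_sumr divfK ?gt_eqF.
rewrite mxE mulr_ge0// ?ler_piMl// ?ler_pdivrMr ?mul1r//.
by rewrite divr_ge0// ltW.
Qed.


Lemma continuous_norm2 : continuous (@norm2 R T).
Proof.
move=> x; rewrite /norm2.

apply: (@continuous_comp _ _ _ (fun x : 'rV[R]_T => \sum_t x 0 t ^+ 2)); last first.
  exact: sqrt_continuous.
suff sq t : continuous (fun x : 'rV[R]_T => x 0 t ^+ 2 : R).
  exact: (continuous_big (op := +%R) (x0 := 0) (P := xpredT) (@add_continuous R)
    (fun t _ => sq t)).
have -> : (fun x : 'rV[R]_T => x 0 t ^+ 2) = (fun x : 'rV[R]_T => x 0 t * x 0 t).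
  by apply/funext => y; rewrite expr2.
by move=> y; apply: (@cvgM _ _ (nbhs y)); exact: (@coord_continuous R 1 T 0 t).
Qed.

Lemma charging_set_compact : compact (charging_set rb E).
Proof.
apply: bounded_closed_compact.
  exists (\sum_t `|rb 0 t|); split; first exact: num_real.
  move=> M bM x [xb _]; rewrite /Num.norm/= mx_normrE.
  apply: bigmax_le => [|[i t] _ /=].
    by apply: le_trans (ltW bM); exact: sumr_ge0.
  rewrite ord1; have /andP[x0 x1] := xb t; rewrite ger0_norm//.
  apply: (le_trans x1); apply: (le_trans (ler_norm _)); apply: le_trans (ltW bM).
  by rewrite (bigD1 t)//= lerDl sumr_ge0.
have -> : charging_set rb E =
    \bigcap_(t in setT) [set x : 'rV[R]_T | 0 <= x 0 t <= rb 0 t] `&`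
    [set x : 'rV[R]_T | \sum_t x 0 t = E].
  by apply/seteqP; split => x [h1 h2]; split => // t; [move=> _|]; exact: h1.
apply: closedI; last first.
  apply: (@preimage_closed 'rV[R]_T R (fun x : 'rV[R]_T => \sum_t x 0 t) [set E]).
    move=> x _.
    exact: (continuous_big (op := +%R) (x0 := 0) (P := xpredT) (@add_continuous R)
      (fun t _ => @coord_continuous R 1 T 0 t)).
  exact: closed_eq.
apply: closed_bigI => t _.
apply: (@preimage_closed 'rV[R]_T R (fun x : 'rV[R]_T => x 0 t)
  [set a | 0 <= a <= rb 0 t]).
  by move=> x _; exact: (@coord_continuous R 1 T 0 t).
rewrite (_ : [set _ | _] = `[0, rb 0 t]%classic); first exact: itv_closed.
by apply/seteqP; split => a; rewrite /= in_itv.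
Qed.

(** The charging set is compact, so the distance to x attains its minimum and
    the chosen projection is a genuine nearest point, not the dummy value. *)
Lemma proj_nearest x : admissible rb E ->
  nearest (charging_set rb E) x (Defs.proj (charging_set rb E) x).
Proof.
move=> adm; rewrite /Defs.proj; apply: xgetPex.
have cdist : continuous (fun y : 'rV[R]_T => norm2 (x - y)).
  move=> y; apply: (@continuous_comp _ _ _ (fun y : 'rV[R]_T => x - y)).
    by apply: (@continuousB _ _ _ (cst x) id) => //; exact: cst_continuous.
  exact: continuous_norm2.
have [c Cc cmin] := EVT_min_rV (charging_set_nonempty adm) charging_set_compact
  (continuous_subspaceT cdist).
exists c; split; first exact: set_mem.
by move=> z Cz; apply: cmin; exact: mem_set.
Qed.

Lemma proj_nonexpansive x y : admissible rb E ->
  norm2 (Defs.proj (charging_set rb E) x - Defs.proj (charging_set rb E) y)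
  <= norm2 (x - y).
Proof.
move=> adm.
exact: nearest_nonexpansive charging_set_convex
  (proj_nearest x adm) (proj_nearest y adm).
Qed.

Lemma proj_contract x u : admissible rb E -> charging_set rb E u ->
  norm2 (Defs.proj (charging_set rb E) x - u) ^+ 2 <= norm2 (x - u) ^+ 2.
Proof.
move=> adm; exact: nearest_contract charging_set_convex (proj_nearest x adm).
Qed.

End ChargingSet.

(** * Polynomial-decay averages *)

Section DecayAverage.
Context {R : realType}.
Variable eta : R.
Hypothesis eta1 : 1 <= eta.

(** The recursion by which the algorithm averages its iterates, applied to
    scalars. Since [theta eta 1 = 1] the initial value is forgotten. *)
Fixpoint decay_avg (N : nat -> R) (k : nat) : R :=
  if k is k'.+1 then
    (1 - theta eta k) * decay_avg N k' + theta eta k * N k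
  else 0.

Lemma theta1 : theta eta 1 = 1.
Proof.
by have e1 := eta1; rewrite /theta divff// gt_eqF//; lra. Qed.

Lemma theta_ge0 k : 0 <= theta eta k.
Proof. by have e1 := eta1; rewrite /theta divr_ge0 ?addr_ge0//; lra. Qed.

Lemma theta_compl k : 1 - theta eta k.+1 = k%:R / (eta + k.+1%:R).
Proof.
have e1 := eta1; have k0 : 0 <= k%:R :> R by [].
have e0 : eta + (1 + k%:R) != 0 by rewrite gt_eqF//; lra.
by rewrite /theta -natr1 addrC [k%:R + 1]addrC; field.
Qed.

Lemma theta_compl_ge0 k : 0 <= 1 - theta eta k.+1.
Proof. by have e1 := eta1; rewrite theta_compl divr_ge0 ?addr_ge0//; lra. Qed.

(** The weights that the averaging gives to successive iterates are
    nondecreasing. *)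
Lemma theta_compl_mul_le k : (1 - theta eta k.+1) * theta eta k <= theta eta k.+1.
Proof.
have e1 := eta1; have k0 : 0 <= k%:R :> R by [].
have ek : 0 < eta + k%:R by lra.
have e2 : 0 < eta + k.+1%:R by rewrite -natr1; lra.
rewrite theta_compl /theta.
rewrite [leLHS](_ : _ = (k%:R / (eta + k%:R)) * ((eta + 1) / (eta + k.+1%:R))).
  by rewrite ler_piMl ?ler_pdivrMr ?divr_ge0 ?(ltW e2)//; lra.
by field; apply/andP; split; apply: lt0r_neq0; lra.
Qed.

(** Averaging [B / sqrt j] with late iterates favoured costs only a factor 2:
    the induction step reduces to [2 * s * t <= s ^ 2 + t ^ 2] for
    [s = sqrt k] and [t = sqrt k.+1]. *)
Lemma decay_avg_le (N : nat -> R) (B : R) : 0 <= B ->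
  (forall k, (0 < k)%N -> N k <= B / Num.sqrt k.+1%:R) ->
  forall k, decay_avg N k <= 2 * B / Num.sqrt k%:R.
Proof.
have e1 := eta1; move=> B0 NB; elim => [|k IH]; first by rewrite /= sqrtr0 invr0 mulr0.
have k0 : 0 <= k%:R :> R by [].
set s := Num.sqrt k%:R in IH; pose t : R := Num.sqrt k.+1%:R.
have s0 : 0 <= s by exact: sqrtr_ge0.
have t0 : 0 < t by rewrite sqrtr_gt0.
have s2 : s ^+ 2 = k%:R by rewrite sqr_sqrtr.
have t2 : t ^+ 2 = k%:R + 1 by rewrite sqr_sqrtr// natr1.
have ss : s ^+ 2 / s = s.
  by have [->|/eqP sn0] := eqVneq s 0; [rewrite expr0n mul0r|field; exact/eqP].
have e2 : 0 < eta + k.+1%:R by rewrite -natr1; lra.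
have Nt : N k.+1 <= B / t.
  rewrite (le_trans (NB _ _))// ler_wpM2l// lef_pV2 ?posrE ?sqrtr_gt0//.
  by rewrite ler_wsqrtr// ler_nat.
rewrite [decay_avg _ _]/=.
apply: (@le_trans _ _ ((1 - theta eta k.+1) * (2 * B / s) + theta eta k.+1 * (B / t))).
  by apply: lerD; apply: ler_wpM2l => //; [exact: theta_compl_ge0|exact: theta_ge0].
rewrite theta_compl -s2 /theta -/t.
have -> : s ^+ 2 / (eta + k.+1%:R) * (2 * B / s)
   = (s ^+ 2 / s) * (2 * B) / (eta + k.+1%:R).
  by rewrite mulrACA -mulrA mulrCA !mulrA; ring.
rewrite ss.
have -> : s * (2 * B) / (eta + k.+1%:R) + (eta + 1) / (eta + k.+1%:R) * (B / t)
   = (B / t) * ((2 * s * t + (eta + 1)) / (eta + k.+1%:R)).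
  by field; apply/andP; split; apply: lt0r_neq0; lra.
rewrite [leRHS](_ : _ = (B / t) * 2); last by ring.
rewrite ler_wpM2l ?divr_ge0// ?(ltW t0)// ler_pdivrMr//.
have := sqr_ge0 (s - t); rewrite -natr1 sqrrB s2 t2; lra.
Qed.

(** Potential argument for the averaged objective [f]: the telescoping
    distances D enter with coefficients b that grow along the averaging, so
    summation by parts leaves only the last coefficient times the diameter Dm.
    This is what removes the logarithm of last-iterate bounds. *)
Lemma weighted_descent (f D N b : nat -> R) (Dm : R) :
  (forall k, (0 < k)%N -> 0 <= b k) ->
  (forall k, (0 < k)%N -> (1 - theta eta k.+1) * b k <= b k.+1) ->
  (forall k, (0 < k)%N -> D k <= Dm) ->
  (forall k, f k.+1 <= (1 - theta eta k.+1) * f k + b k.+1 * (D k.+1 - D k.+2)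
      + theta eta k.+1 * N k.+1) ->
  forall k, (0 < k)%N -> f k + b k * D k.+1 <= decay_avg N k + b k * Dm.
Proof.
move=> b0 bb DD ff; elim => // -[|k] IH _.
  have := ff 0; rewrite /= theta1 subrr !mul0r !add0r mul1r.
  have : b 1 * D 1 <= b 1 * Dm by rewrite ler_wpM2l ?b0 ?DD.
  lra.
have {}IH := IH erefl; have := ff k.+1.
rewrite [decay_avg _ k.+2](_ : _ = (1 - theta eta k.+2) * decay_avg N k.+1
  + theta eta k.+2 * N k.+2)//.
move: (decay_avg N k.+1) (theta_compl_ge0 k.+1) IH => Z.
have := bb k.+1 erefl; have := DD k.+2 erefl.
move: (1 - theta eta k.+2) => a Dk ab a0 IH fk.
have h1 := ler_wpM2l a0 IH.
have : 0 <= (b k.+2 - a * b k.+1) * (Dm - D k.+2) by rewrite mulr_ge0// subr_ge0.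
lra.
Qed.

End DecayAverage.

(** * Regret along one realization of the noise *)

Section PathwiseRegret.
Context {R : realType} {T n : nat}.
Variables (rbar : 'I_n -> 'rV[R]_T) (E : 'I_n -> R) (m : R) (d : 'rV[R]_T).
Hypothesis adm : forall i, admissible (rbar i) (E i).

(** With a and b the arguments of the squared norms at x and u, the claim is
    that |a - b| squared is nonnegative. *)
Lemma costU_gradient_ineq (x u : 'rV[R]_T) :
  costU m d x - costU m d u <= dot (gradU m d x) (x - u).
Proof.
rewrite /costU /gradU !norm2_sq dotZl -dotZr.
set a := d + m^-1 *: x; set b := d + m^-1 *: u.
have -> : m^-1 *: (x - u) = a - b.
  by rewrite /a /b scalerBr; apply/rowP=> t; rewrite !mxE; ring.
have := dot_ge0 (a - b); rewrite dotBl !dotBr (dotC b a); lra.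
Qed.

(** Average the gradient inequalities at the intermediate point. *)
Lemma costU_convex (x y : 'rV[R]_T) (a : R) : 0 <= a -> 0 <= 1 - a ->
  costU m d ((1 - a) *: x + a *: y) <= (1 - a) * costU m d x + a * costU m d y.
Proof.
move=> a0 a1; set z := _ *: x + _.
have := costU_gradient_ineq z y; have := costU_gradient_ineq z x.
move=> hx hy.
have := ler_wpM2l a0 hy; have := ler_wpM2l a1 hx.
have : (1 - a) * dot (gradU m d z) (z - x) + a * dot (gradU m d z) (z - y) = 0.
  rewrite -(dotZr (1 - a)) -(dotZr a) -dotDr.
  rewrite (_ : _ *: (z - x) + _ = 0); first by rewrite dotC dot0l.
  by apply/rowP => t; rewrite !mxE; ring.
lra.
Qed.

Definition sqdist (r u : 'I_n -> 'rV[R]_T) : R := \sum_i norm2 (r i - u i) ^+ 2.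

Lemma sqdist_ge0 r u : 0 <= sqdist r u.
Proof. by apply: sumr_ge0 => i _; rewrite sqr_ge0. Qed.

(** Every user moves along the same vector p, so the n first-order terms add up
    to one inner product with the aggregate and the second-order term is
    multiplied by n. *)
Lemma projected_step_sqdist (r u : 'I_n -> 'rV[R]_T) (a : R) (p : 'rV[R]_T) :
  feasible rbar E u ->
  sqdist (fun i => Defs.proj (charging_set (rbar i) (E i)) (r i - a *: p)) u <=
  sqdist r u - 2 * a * dot p (\sum_i r i - \sum_i u i) + a ^+ 2 * n%:R * norm2 p ^+ 2.
Proof.
move=> fu.
have -> : sqdist r u - 2 * a * dot p (\sum_i r i - \sum_i u i)
    + a ^+ 2 * n%:R * norm2 p ^+ 2 = \sum_i norm2 (r i - a *: p - u i) ^+ 2.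
  rewrite -sumrB dot_sumr mulr_sumr.
  have -> : a ^+ 2 * n%:R * norm2 p ^+ 2 = \sum_(i < n) (a ^+ 2 * norm2 p ^+ 2).
    by rewrite sumr_const card_ord -mulr_natr; ring.
  rewrite -sumrB -big_split; apply: eq_bigr => i _ /=.
  rewrite (_ : r i - a *: p - u i = (r i - u i) - a *: p); last first.
    by apply/rowP => t; rewrite !mxE; ring.
  move: (r i - u i) => v; rewrite !norm2_sq dotBl !dotBr !dotZl !dotZr (dotC v p); ring.
by apply: ler_sum => i _; exact: proj_contract.
Qed.

Variables (eta : R) (alpha : nat -> R) (w : nat -> 'rV[R]_T) (r1 : 'I_n -> 'rV[R]_T).
Hypothesis eta1 : 1 <= eta.

Local Notation st := (dpgd rbar E m d eta alpha w r1).

Definition iterate j := (st j).1.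
Definition averaged j := (st j).2.

Lemma iterateS j : iterate j.+1 = fun i =>
  Defs.proj (charging_set (rbar i) (E i)) (iterate j i - alpha j.+1 *:
    (gradU m d (\sum_i iterate j i) + (if j.+1 == 1%N then 0 else w j.+1))).
Proof. by rewrite /iterate /=; case: (st j). Qed.

Lemma averagedS j : averaged j.+1 = fun i =>
  (1 - theta eta j.+1) *: averaged j i + theta eta j.+1 *: iterate j.+1 i.
Proof. by rewrite /iterate /averaged /=; case: (st j). Qed.

(** Whatever the initial point, a projection has been made after one round. *)
Lemma iterate_feasible j : feasible rbar E (iterate j.+1).
Proof. by rewrite iterateS => i; apply: (proj_nearest _ (adm i)).1. Qed.

(** The arbitrary initial point has weight [1 - theta eta 1 = 0]. *)
Lemma averaged_feasible j : feasible rbar E (averaged j.+1).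
Proof.
elim: j => [|j IH] i; rewrite averagedS.
  by rewrite theta1// subrr scale0r scale1r add0r; exact: (iterate_feasible 0 i).
apply: charging_set_convex => //; first exact: (iterate_feasible j.+1 i).
by rewrite theta_ge0//= -subr_ge0 theta_compl_ge0.
Qed.

Lemma averaged_sumS j : \sum_i averaged j.+1 i =
  (1 - theta eta j.+1) *: (\sum_i averaged j i)
  + theta eta j.+1 *: (\sum_i iterate j.+1 i).
Proof. by rewrite averagedS !scaler_sumr -big_split. Qed.

Variables (c G Dm : R).
Hypothesis c0 : 0 < c.
Hypothesis alphaE : forall k, alpha k = c / Num.sqrt k%:R.
Hypothesis gradG : forall r, feasible rbar E r -> norm2 (gradU m d (\sum_i r i)) <= G.
Hypothesis DmP : forall r u, feasible rbar E r -> feasible rbar E u -> sqdist r u <= Dm.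

(** The part of the regret of round k.+1 against u that does not telescope: a
    second-order part and an inner product that will have mean zero. The squared norm of
    the noisy gradient is at most twice the sum of the squares, which absorbs
    the factor 1/2 in front of the step size. *)
Definition regret_term (u : 'I_n -> 'rV[R]_T) (k : nat) : R :=
  c / Num.sqrt k.+1%:R * n%:R * (G ^+ 2 + norm2 (w k.+1) ^+ 2)
  - dot (w k.+1) (\sum_i iterate k i - \sum_i u i).

(** The gradient is evaluated at an iterate that is already feasible, so the
    bound G applies; this is why round 1 is left out. *)
Lemma one_step_regret u k : feasible rbar E u ->
  costU m d (\sum_i iterate k.+1 i) - costU m d (\sum_i u i) <=
  (2 * alpha k.+2)^-1 * (sqdist (iterate k.+1) u - sqdist (iterate k.+2) u)
  + regret_term u k.+1.
Proof.
move=> fu; set x := iterate k.+1; set a := alpha k.+2.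
have a0 : 0 < a by rewrite /a alphaE divr_gt0// sqrtr_gt0.
have := projected_step_sqdist x a (gradU m d (\sum_i x i) + w k.+2) fu.
rewrite -[X in sqdist X _](iterateS k.+1) -/x.
have := costU_gradient_ineq (\sum_i x i) (\sum_i u i).
have gG : norm2 (gradU m d (\sum_i x i)) ^+ 2 <= G ^+ 2.
  have gG := gradG (iterate_feasible k).
  by rewrite ler_pXn2r ?nnegrE ?norm2_ge0// (le_trans (norm2_ge0 _) gG).
have := norm2D_sq_le (gradU m d (\sum_i x i)) (w k.+2).
rewrite /regret_term -/x -alphaE -/a dotDl.
move: (norm2 (_ + _) ^+ 2) (norm2 (w _) ^+ 2) (norm2 (gradU _ _ _) ^+ 2) gG => P W g gG.
move: (dot (gradU m d _) _) (dot (w _) _) (sqdist x u) (sqdist _ u) => q s D D'.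
move: (costU m d (\sum_i u i)) (costU m d _) => cu cx hP hc hD.
have n0 : 0 <= n%:R :> R by [].
have h1 : a ^+ 2 * n%:R * P <= a ^+ 2 * n%:R * (2 * (G ^+ 2 + W)).
  by rewrite ler_wpM2l ?mulr_ge0 ?sqr_ge0//; lra.
have h2 : 2 * a * q <= D - D' + 2 * a * (a * n%:R * (G ^+ 2 + W) - s) by lra.
have : q <= (2 * a)^-1 * (D - D' + 2 * a * (a * n%:R * (G ^+ 2 + W) - s)).
  by rewrite mulrC ler_pdivlMr ?mulr_gt0// mulrC.
rewrite mulrDr mulKf ?mulf_neq0 ?gt_eqF//; lra.
Qed.

(** The output averages the iterates after rounds 1 to K, and the regret of the
    iterate after round k is controlled by the step of round k.+1. Hence a
    fictitious round K.+1 appears; its result is only used through the sign of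
    a squared distance. *)
Lemma pathwise_regret u K : feasible rbar E u -> (0 < K)%N ->
  costU m d (\sum_i averaged K i) - costU m d (\sum_i u i) <=
  decay_avg eta (regret_term u) K
  + theta eta K * Num.sqrt K.+1%:R / (2 * c) * Dm.
Proof.
move=> fu K0.
(* The coefficient of the telescoping squared distances. *)
pose b k := theta eta k * (2 * alpha k.+1)^-1.
have bE k : b k = theta eta k * Num.sqrt k.+1%:R / (2 * c).
  have : 0 < Num.sqrt k.+1%:R :> R by rewrite sqrtr_gt0.
  rewrite /b alphaE; move: (Num.sqrt _) => s s0; have cp := c0.
  by field; rewrite !gt_eqF.
have b0 k : 0 <= b k.
  rewrite bE; apply: mulr_ge0; first by rewrite mulr_ge0 ?theta_ge0.
  by rewrite invr_ge0 mulr_ge0// ltW.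
rewrite -bE.
apply: (@le_trans _ _ (costU m d (\sum_i averaged K i) - costU m d (\sum_i u i)
  + b K * sqdist (iterate K.+1) u)).
  by rewrite lerDl mulr_ge0// sqdist_ge0.
apply: (@weighted_descent R eta eta1
  (fun k => costU m d (\sum_i averaged k i) - costU m d (\sum_i u i))
  (fun k => sqdist (iterate k) u) (regret_term u) b Dm) => // k.
- move=> _; rewrite !bE [leLHS]mulrA ler_wpM2r ?invr_ge0 ?mulr_ge0 ?(ltW c0)//.
  rewrite mulrA; apply: ler_pM; rewrite ?sqrtr_ge0 ?theta_compl_mul_le//.
    by rewrite mulr_ge0 ?theta_ge0 ?theta_compl_ge0.
  by rewrite ler_wsqrtr// ler_nat.
- by case: k => // k _; apply: DmP => //; exact: iterate_feasible.
- have := costU_convex (\sum_i averaged k i) (\sum_i iterate k.+1 i)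
    (theta_ge0 eta1 k.+1) (theta_compl_ge0 eta1 k).
  rewrite -averaged_sumS.
  have := ler_wpM2l (theta_ge0 eta1 k.+1) (one_step_regret k fu).
  rewrite /b /=; move: (2 * alpha _)^-1.
  move: (costU m d _) (costU m d _) (costU m d _) (costU m d _) => f1 f2 f3 f4 q.
  lra.
Qed.

End PathwiseRegret.

(** * The iterated Lebesgue integral *)

Section IteratedLebesgueIntegral.
Local Open Scope ereal_scope.
Context {R : realType}.
Local Notation mu := (@lebesgue_measure R).
Local Notation dilate a := ( *%R a : measurableTypeR R -> measurableTypeR R).
Local Notation lti := (@lebesgue_tuple_int R _).

Lemma lti_ge0 T (f : T.-tuple R -> \bar R) : (forall v, 0 <= f v) -> 0 <= lti f.
Proof.
elim: T f => [|T IH] f f0 //=.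
by apply: integral_ge0 => x _; exact: IH.
Qed.

(** The parameter space D absorbs one coordinate at each step of the induction,
    which turns the inductive step into Tonelli's theorem. *)
Lemma measurable_lti_param T d (D : measurableType d) (f : D * T.-tuple R -> \bar R) :
  measurable_fun setT f -> (forall x, 0 <= f x) ->
  measurable_fun setT (fun x => lti (fun v => f (x, v))).
Proof.
elim: T d D f => [|T IH] d D f mf f0 /=.
  apply: (measurableT_comp mf); exact: measurable_fun_pair.
pose g (z : (D * measurableTypeR R) * T.-tuple R) :=
  f (z.1.1, [tuple of z.1.2 :: z.2]).
have mg : measurable_fun setT g.
  apply: (measurableT_comp mf); apply: measurable_fun_pair.
    exact: (measurableT_comp measurable_fst).
  apply: (@measurable_cons _ _ _ _
    (fun z : (D * measurableTypeR R) * T.-tuple R => z.1.2)) => //.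
  exact: (measurableT_comp measurable_snd).
have mG := IH _ (D * measurableTypeR R)%type g mg (fun z => f0 _).
apply: (@measurable_fun_fubini_tonelli_F _ _ D (measurableTypeR R) R mu _ mG).
by move=> z; apply: lti_ge0 => v; exact: f0.
Qed.

Lemma measurable_lti_cons T (f : T.+1.-tuple R -> \bar R) :
  measurable_fun setT f -> (forall v, 0 <= f v) ->
  measurable_fun setT (fun x : measurableTypeR R =>
    lti (fun v : T.-tuple R => f [tuple of x :: v])).
Proof.
move=> mf f0.
apply: (@measurable_lti_param T _ (measurableTypeR R)
  (fun z => f [tuple of z.1 :: z.2])) => //.
by apply: (measurableT_comp mf); exact: measurable_cons.
Qed.

Lemma measurable_comp_cons T (f : T.+1.-tuple R -> \bar R) (x : R) :
  measurable_fun setT f ->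
  measurable_fun setT (fun v : T.-tuple R => f [tuple of x :: v]).
Proof. by move=> mf; apply: (measurableT_comp mf); exact: measurable_cons. Qed.

Lemma le_lti T (f g : T.-tuple R -> \bar R) :
  measurable_fun setT f -> measurable_fun setT g ->
  (forall v, 0 <= f v) -> (forall v, f v <= g v) -> lti f <= lti g.
Proof.
elim: T f g => [|T IH] f g mf mg f0 fg //=.
have g0 v : 0 <= g v by exact: le_trans (f0 v) (fg v).
apply: ge0_le_integral => //.
- by move=> x _; exact: lti_ge0.
- exact: measurable_lti_cons.
- exact: measurable_lti_cons.
- by move=> x _; apply: IH => //; exact: measurable_comp_cons.
Qed.

Lemma ltiZ T (f : T.-tuple R -> \bar R) (k : R) : (0 <= k)%R ->
  measurable_fun setT f -> (forall v, 0 <= f v) ->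
  lti (fun v => k%:E * f v) = k%:E * lti f.
Proof.
move=> k0; elim: T f => [|T IH] f mf f0 //=.
under eq_integral do (rewrite IH//; last exact: measurable_comp_cons).
by rewrite ge0_integralZl//; [exact: measurable_lti_cons|move=> x _; exact: lti_ge0].
Qed.

Lemma ltiD T (f g : T.-tuple R -> \bar R) :
  measurable_fun setT f -> measurable_fun setT g ->
  (forall v, 0 <= f v) -> (forall v, 0 <= g v) ->
  lti (fun v => f v + g v) = lti f + lti g.
Proof.
elim: T f g => [|T IH] f g mf mg f0 g0 //=.
under eq_integral do (rewrite IH//; [|exact: measurable_comp_cons..]).
rewrite ge0_integralD//; do ?exact: measurable_lti_cons.
- by move=> x _; exact: lti_ge0.
- by move=> x _; exact: lti_ge0.
Qed.

Lemma lti0 T : lti (fun _ : T.-tuple R => 0) = 0.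
Proof. by elim: T => //= T IH; under eq_integral do rewrite IH; rewrite integral0. Qed.

Lemma lti_sum T (I : Type) (s : seq I) (f : I -> T.-tuple R -> \bar R) :
  (forall i, measurable_fun setT (f i)) -> (forall i v, 0 <= f i v) ->
  lti (fun v => \sum_(i <- s) f i v) = \sum_(i <- s) lti (f i).
Proof.
move=> mf f0; elim: s => [|i s IH].
  by rewrite big_nil -[RHS](lti0 T); congr lti; apply/funext => v; rewrite big_nil.
rewrite big_cons -IH -ltiD//.
- by congr lti; apply/funext => v; rewrite big_cons.
- exact: emeasurable_sum.
- by move=> v; exact: sume_ge0.
Qed.

Lemma lti_monotone_convergence T (f : nat -> T.-tuple R -> \bar R)
    (g : T.-tuple R -> \bar R) :
  (forall n, measurable_fun setT (f n)) -> (forall n v, 0 <= f n v) ->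
  (forall v, {homo f ^~ v : a b / (a <= b)%N >-> a <= b}) ->
  (forall v, f ^~ v @ \oo --> g v) ->
  lti (f n) @[n --> \oo] --> lti g.
Proof.
elim: T f g => [|T IH] f g mf f0 ndf fg //=.
have -> : \int[mu]_x lti (fun v : T.-tuple R => g [tuple of x :: v]) =
  \int[mu]_x limn (fun n => lti (fun v : T.-tuple R => f n [tuple of x :: v])).
  apply: eq_integral => x _; apply/esym/cvg_lim => //.
  by apply: IH => // n; exact: measurable_comp_cons.
apply: cvg_monotone_convergence => //.
- by move=> n; exact: measurable_lti_cons.
- by move=> n x _; exact: lti_ge0.
- move=> x _ a b ab; apply: le_lti; do ?exact: measurable_comp_cons; first by [].
  by move=> v; exact: ndf.
Qed.

Definition tscale T (b : R) (v : T.-tuple R) : T.-tuple R := [tuple of map ( *%R b) v].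

Lemma tscale_cons T b x (v : T.-tuple R) :
  tscale b [tuple of x :: v] = [tuple of (b * x)%R :: tscale b v].
Proof. exact: val_inj. Qed.

Lemma row_of_tscale T b (v : T.-tuple R) :
  row_of_tuple (tscale b v) = (b *: row_of_tuple v)%R.
Proof. by apply/rowP => t; rewrite !mxE tnth_map. Qed.

Lemma measurable_tscale T b : measurable_fun setT (@tscale T b).
Proof.
apply/measurable_fun_tnthP => i.
rewrite (_ : _ \o _ =
  (fun x => b * x)%R \o (fun v : T.-tuple R => tnth v i)); last first.
  by apply/funext => v /=; rewrite tnth_map.
apply: measurableT_comp; first exact: mulrl_measurable.
exact: measurable_tnth.
Qed.

(** The one-dimensional change of variables is a hypothesis, so that dilations
    and the reflection share one proof. *)
Lemma lti_tscale T (b k : R) (f : T.-tuple R -> \bar R) : (0 <= k)%R ->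
  (forall h : R -> \bar R, measurable_fun setT h -> (forall x, 0 <= h x) ->
     \int[mu]_x h (b * x)%R = k%:E * \int[mu]_x h x) ->
  measurable_fun setT f -> (forall v, 0 <= f v) ->
  lti (fun v => f (tscale b v)) = (k ^+ T)%:E * lti f.
Proof.
move=> k0 hk; elim: T f => [|T IH] f mf f0 /=.
  by rewrite expr0 mul1e; congr f; exact: val_inj.
under eq_integral.
  move=> x _.
  rewrite (_ : (fun v => _) = (fun v : T.-tuple R =>
    f [tuple of (b * x)%R :: tscale b v])); last first.
    by apply/funext => v; rewrite tscale_cons.
  rewrite (IH (fun v => f [tuple of (b * x)%R :: v]))//; last first.
    exact: measurable_comp_cons.
  over.
rewrite ge0_integralZl//; last first.
- by rewrite lee_fin exprn_ge0.
- by move=> x _; exact: lti_ge0.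
- apply: (measurableT_comp (measurable_lti_cons mf f0)); exact: mulrl_measurable.
rewrite (hk (fun x => lti (fun v : T.-tuple R => f [tuple of x :: v]))).
- by rewrite muleA -EFinM -exprSr.
- exact: measurable_lti_cons.
- by move=> x; exact: lti_ge0.
Qed.

Lemma lebesgue_integral_opp (h : R -> \bar R) :
  measurable_fun setT h -> (forall x, 0 <= h x) ->
  \int[mu]_x h (- 1 * x)%R = 1%:E * \int[mu]_x h x.
Proof.
move=> mh h0; rewrite mul1e.
under eq_integral do rewrite mulN1r.
rewrite -[LHS](@ge0_integral_pushforward _ _ _ _ _
  (-%R : measurableTypeR R -> measurableTypeR R) _ mu setT h)//.
by apply: eq_measure_integral => A mA _; exact: lebesgue_measureN.
Qed.

(** Both sides agree on half-open intervals. *)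
Lemma lebesgue_measure_preimage_dilate (a : R) (a0 : (0 < a)%R) (A : set R) :
  measurable A ->
  mu A = a%:E * mu (( *%R a) @^-1` A).
Proof.
have ma : measurable_fun setT (dilate a).
  exact: mulrl_measurable.
pose k : {nonneg R} := NngNum (ltW a0).
move=> mA.
rewrite (@lebesgue_measure_unique R (mscale k (pushforward mu (dilate a))))
  => [|_ [[x y]] _ <-|//].
  by [].
rewrite /mscale /pushforward /=.
transitivity (a%:E * mu (( *%R a) @^-1` `]x, y])); last by [].
have -> : ( *%R a) @^-1` `]x, y] = `](x / a)%R, (y / a)%R]%classic.
  apply/seteqP; split => z; rewrite /= !in_itv/= ltr_pdivrMr// ler_pdivlMr//;
  by rewrite mulrC.
rewrite !lebesgue_measure_itv/= !lte_fin ltr_pM2r ?invr_gt0//.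
case: ifPn => _; last by rewrite mule0.
by rewrite -!EFinD -EFinM -mulrBl mulrC divfK// gt_eqF.
Qed.

Lemma lebesgue_integral_dilate (a : R) (h : R -> \bar R) : (0 < a)%R ->
  measurable_fun setT h -> (forall x, 0 <= h x) ->
  \int[mu]_x h (a * x)%R = a^-1%:E * \int[mu]_x h x.
Proof.
move=> a0 mh h0.
have ma : measurable_fun setT (dilate a).
  exact: mulrl_measurable.
rewrite -[LHS](@ge0_integral_pushforward _ _ _ _ _ (dilate a) _ mu setT h)//.
pose k : {nonneg R} := NngNum (ltW a0).
have -> : \int[mu]_x h x = a%:E *
    \int[pushforward mu (dilate a)]_x h x.
  rewrite -[RHS](@ge0_integral_mscale _ _ _ (pushforward mu (dilate a)) setT _ k)//.
  apply: eq_measure_integral => A mA _.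
  exact: (lebesgue_measure_preimage_dilate a0 mA).
by rewrite muleA -EFinM mulVf ?gt_eqF// mul1e.
Qed.

End IteratedLebesgueIntegral.

(** * Laws with a density, and the exponential noise *)

Section Density.
Local Open Scope ereal_scope.
Context {R : realType} {T : nat}.
Local Notation lti := (@lebesgue_tuple_int R _).
Variable nu : {measure set (T.-tuple R) -> \bar R}.
Variables (f : T.-tuple R -> R) (c : R).
Hypothesis f0 : forall v, (0 <= f v)%R.
Hypothesis mf : measurable_fun setT f.
Hypothesis nuE : forall B, measurable B ->
  nu B = c%:E * lti (fun v => (\1_B v * f v)%:E).

Import HBNNSimple.

(** Linearity of both sides reduces a simple function to the indicators of its
    level sets. *)
Lemma sintegral_density (h : {nnsfun (T.-tuple R) >-> R}) :
  \int[nu]_v (h v)%:E = c%:E * lti (fun v => (h v * f v)%:E).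
Proof.
have mind (x : R) : measurable_fun setT (fun v => (\1_(h @^-1` [set x]) v * f v)%:E).
  by apply/measurable_EFinP; apply: measurable_funM => //; exact: measurable_indic.
have ind0 (x : R) v : 0 <= (\1_(h @^-1` [set x]) v * f v)%:E.
  by rewrite lee_fin mulr_ge0.
rewrite integralT_nnsfun sintegralE.
have fin : finite_set (range h) by [].
rewrite fsbig_finite//=.
set r := finmap.enum_fset (fset_set (range h)).
(* The zero branch keeps every summand nonnegative; h attains no negative
   value. *)
pose F (x : R) v := if (0 <= x)%R then
  x%:E * (\1_(h @^-1` [set x]) v * f v)%:E else 0.
have -> : (fun v => (h v * f v)%:E) = fun v => \sum_(x <- r) F x v.
  apply/funext => v.
  rewrite {1}fimfunE fsbig_finite//= mulr_suml -sumEFin; apply: eq_bigr => x _.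
  rewrite /F; case: ifPn => [_|xn]; first by rewrite -EFinM mulrA.
  rewrite indicE memNset ?mulr0 ?mul0r//= => hx.
  by move: xn; rewrite -hx fun_ge0.
rewrite (@lti_sum _ _ _ r F); last 2 first.
- by move=> x; rewrite /F; case: (boolP (0 <= x)%R) => _ //; exact: measurable_funeM.
- by move=> x v; rewrite /F; case: ifPn => x0 //; rewrite mule_ge0.
rewrite ge0_sume_distrr; last first.
  move=> x _; apply: lti_ge0 => v; rewrite /F; case: ifPn => x0 //.
  by rewrite mule_ge0.
apply: eq_big_seq => x; rewrite in_fset_set// inE => -[v _ vx].
have x0 : (0 <= x)%R by rewrite -vx fun_ge0.
by rewrite /F x0 ltiZ// nuE// muleCA.
Qed.

Lemma integral_density (g : T.-tuple R -> R) :
  measurable_fun setT g -> (forall v, 0 <= g v)%R ->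
  \int[nu]_v (g v)%:E = c%:E * lti (fun v => (g v * f v)%:E).
Proof.
move=> mg g0.
have mEg : measurable_fun setT (EFin \o g) by exact/measurable_EFinP.
pose h := nnsfun_approx measurableT mEg.
have ndh v : {homo (fun n => h n v) : a b / (a <= b)%N >-> (a <= b)%R}.
  by move=> a b ab; exact/lefP/nd_nnsfun_approx.
have cvgh v : (fun n => (h n v)%:E) @ \oo --> (g v)%:E.
  by apply: (@cvg_nnsfun_approx _ _ _ _ _ _ mEg) => // x _; rewrite lee_fin.
have L1 : \int[nu]_v (h n v)%:E @[n --> \oo] --> \int[nu]_v (g v)%:E.
  rewrite (_ : \int[nu]_v (g v)%:E = \int[nu]_v limn (fun n => (h n v)%:E)).
    apply: cvg_monotone_convergence => //.
    - by move=> n; exact/measurable_EFinP.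
    - by move=> n v _; rewrite lee_fin.
    - by move=> v _ a b ab; rewrite lee_fin ndh.
  by apply: eq_integral => v _; apply/esym/cvg_lim.
have L2 : c%:E * lti (fun v => (h n v * f v)%:E) @[n --> \oo]
    --> c%:E * lti (fun v => (g v * f v)%:E).
  apply: cvgeZl => //; apply: lti_monotone_convergence.
  - by move=> n; apply/measurable_EFinP; exact: measurable_funM.
  - by move=> n v; rewrite lee_fin mulr_ge0.
  - by move=> v a b ab; rewrite lee_fin ler_wpM2r// ndh.
  - move=> v; under eq_fun do rewrite EFinM.
    by rewrite EFinM; apply: cvgeZr.
rewrite -(cvg_lim _ L1)// -(cvg_lim _ L2)//.
by congr (limn _); apply/funext => n; exact: sintegral_density.
Qed.

End Density.

Lemma measurable_norm2_row {R : realType} (T : nat) :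
  measurable_fun setT (fun v : T.-tuple R => norm2 (row_of_tuple v)).
Proof.
rewrite /norm2.
apply: (@measurableT_comp _ _ _ _ _ _ (@Num.sqrt R)).
  exact: continuous_measurable_fun (@sqrt_continuous R).
apply: measurable_sum => t.
apply: (measurable_funX 2).
rewrite (_ : (fun _ => _) = fun v : T.-tuple R => tnth v t).
  exact: measurable_tnth.
by apply/funext => v; rewrite mxE.
Qed.

Lemma bernoulli_ineq {R : realType} (y : R) n : 0 <= y <= 1 ->
  1 - n%:R * y <= (1 - y) ^+ n.
Proof.
move=> /andP[y0 y1]; elim: n => [|n IH]; first by rewrite expr0 mul0r subr0.
have y1' : 0 <= 1 - y by lra.
have := ler_wpM2l y1' IH; rewrite -exprS => /(le_trans _); apply.
rewrite -natr1; have : 0 <= n%:R * (y * y) by rewrite !mulr_ge0.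
lra.
Qed.

Section ExponentialNoise.
Local Open Scope ereal_scope.
Context {R : realType} {T : nat}.
Hypothesis T0 : (0 < T)%N.
Local Notation lti := (@lebesgue_tuple_int R _).
Variable nu : probability (T.-tuple R) R.
Variables (lam c : R).
Hypothesis lam0 : (0 < lam)%R.
Hypothesis c0 : (0 < c)%R.
Let f (v : T.-tuple R) := expR (- (lam * norm2 (row_of_tuple v))).
Hypothesis nuE : forall B, measurable B ->
  nu B = c%:E * lti (fun v => (\1_B v * f v)%:E).

Let mnorm := @measurable_norm2_row R T.

Let mexp (a : R) :
  measurable_fun setT (fun v : T.-tuple R => expR (- (a * norm2 (row_of_tuple v)))).
Proof.
apply: measurableT_comp => //; apply: measurableT_comp => //.
exact: measurable_funM.
Qed.

(** The normalization of a probability makes the integral of the exponential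
    finite and eliminates its value from all later estimates. *)
Lemma exponential_noise_mass : c%:E * lti (fun v => (f v)%:E) = 1.
Proof.
have := nuE measurableT; rewrite probability_setT => ->; congr (_ * lti _).
by apply/funext => v; rewrite indicT mul1r.
Qed.

(** No polar coordinates are involved: [x ^ 2 <= 2 / s ^ 2 * exp (s * x)]
    replaces the squared norm by a slower exponential decay, which is the
    original density dilated by [b = 1 - s / lam], of mass [b ^ - T] instead
    of 1. For [s = lam / (2 T)] Bernoulli's inequality bounds that mass by 2.
    The result has the right order in T and lam, the exact value being
    [T * (T + 1) / lam ^ 2]. *)
Lemma exponential_noise_second_moment :
  \int[nu]_v (norm2 (row_of_tuple v) ^+ 2)%:E <= (16 * T%:R ^+ 2 / lam ^+ 2)%:E.
Proof.
have Tr : (0 < T%:R :> R)%R by rewrite ltr0n.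
have T1 : (1 <= T%:R :> R)%R by rewrite ler1n.
pose s := (lam / (2 * T%:R))%R; pose b : R := (1 - (2 * T%:R)^-1)%R.
have sb : (lam * b = lam - s)%R by rewrite /b /s mulrBr mulr1.
have b0 : (0 < b)%R.
  by rewrite subr_gt0 invf_lt1 ?mulr_gt0//; have := T1; lra.
have s0 : (0 < s)%R by rewrite divr_gt0// mulr_gt0.
rewrite (@integral_density _ _ nu f c _ _ nuE)//; last 4 first.
- by move=> v; exact: expR_ge0.
- exact: mexp.
- exact: measurable_funX.
- by move=> v; exact: sqr_ge0.
pose g (v : T.-tuple R) := (expR (- (lam * norm2 (row_of_tuple v))))%:E.
have mg : measurable_fun setT g by apply/measurable_EFinP; exact: mexp.
have g0 v : 0 <= g v by rewrite lee_fin expR_ge0.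
have tail : lti (fun v => (norm2 (row_of_tuple v) ^+ 2 * f v)%:E)
    <= lti (fun v => (2 / s ^+ 2)%:E * g (tscale b v)).
  apply: le_lti.
  - apply/measurable_EFinP.
    by apply: measurable_funM; [exact: measurable_funX|exact: mexp].
  - by apply: measurable_funeM; apply: (measurableT_comp mg); exact: measurable_tscale.
  - by move=> v; rewrite lee_fin mulr_ge0 ?expR_ge0 ?sqr_ge0.
  move=> v; rewrite /g -EFinM lee_fin row_of_tscale norm2Z (gtr0_norm b0).
  rewrite mulrA sb /f; set x := norm2 _.
  have x0 : (0 <= x)%R by exact: norm2_ge0.
  have -> : (- ((lam - s) * x) = s * x + - (lam * x))%R by ring.
  rewrite expRD mulrA ler_wpM2r ?expR_ge0//.
  have sx : (0 <= s * x)%R by rewrite mulr_ge0// ltW.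
  have : ((s * x) ^+ 2 / 2 <= expR (s * x))%R.
    apply: (le_trans _ (expR_ge1Dxn 1 sx)) => //.
    rewrite lerDr//.
  have s20 : (0 < s ^+ 2)%R by rewrite exprn_gt0.
  by rewrite exprMn => h; rewrite mulrAC ler_pdivlMr//; lra.
have scale : lti (fun v => g (tscale b v)) = ((b^-1) ^+ T)%:E * lti g.
  apply: lti_tscale => //; first by rewrite invr_ge0 ltW.
  by move=> h mh h0; apply: lebesgue_integral_dilate.
have bT : (b^-1 ^+ T <= 2)%R.
  rewrite exprVn invf_ple ?posrE ?exprn_gt0//.
  have y0 : (0 <= (2 * T%:R : R)^-1 <= 1)%R.
    by rewrite invr_ge0 mulr_ge0//= -subr_ge0 ltW.
  apply: le_trans (bernoulli_ineq T y0).
  have -> : (T%:R * (2 * T%:R)^-1 = 2^-1 :> R)%R by field; rewrite gt_eqF.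
  lra.
apply: (@le_trans _ _ (c%:E * ((2 / s ^+ 2)%:E * (2%:E * lti g)))).
  rewrite lee_pmul2l ?lte_fin//; apply: (le_trans tail).
  have ms : measurable_fun setT (fun v => g (tscale b v)).
    by apply: (measurableT_comp mg); exact: measurable_tscale.
  have s2 : (0 <= 2 / s ^+ 2)%R by rewrite divr_ge0// sqr_ge0.
  rewrite (ltiZ s2 ms (fun v => g0 _)) scale.
  apply: lee_wpmul2l; first by rewrite lee_fin.
  by apply: lee_wpmul2r; [exact: lti_ge0|rewrite lee_fin].
rewrite muleCA [c%:E * _]muleCA exponential_noise_mass mule1 -EFinM lee_fin /s.
rewrite le_eqVlt; apply/orP; left; apply/eqP; field.
by rewrite !gt_eqF.
Qed.

(** The density depends on the norm only, and the Lebesgue integral is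
    invariant under reflection. *)
Lemma exponential_noise_symmetric B : measurable B ->
  nu (tscale (-1) @^-1` B) = nu B.
Proof.
move=> mB; have mB' : measurable (@tscale R T (-1) @^-1` B).
  by rewrite -[_ @^-1` _]setTI; exact: measurable_tscale.
rewrite !nuE//; congr (_ * _).
transitivity (lti (fun v => (fun u => (\1_B u * f u)%:E) (tscale (-1) v))).
  by congr lti; apply/funext => v /=; rewrite /f row_of_tscale norm2Z normrN1 mul1r.
rewrite (@lti_tscale _ _ (-1) 1 (fun u => (\1_B u * f u)%:E))//.
- by rewrite expr1n mul1e.
- by move=> h mh h0; exact: lebesgue_integral_opp.
- apply/measurable_EFinP.
  by apply: measurable_funM; [exact: measurable_indic|exact: mexp].
- by move=> v; rewrite lee_fin mulr_ge0// expR_ge0.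
Qed.

End ExponentialNoise.

(** * Measurability of the iterates *)

Section RowMeasurability.
Context {R : realType} {T : nat} {disp : measure_display} {H : measurableType disp}.
Implicit Types X Y : H -> 'rV[R]_T.

Definition measurable_row X := forall t, measurable_fun setT (fun h => X h 0 t : R).

Lemma measurable_row_cst (x : 'rV[R]_T) : measurable_row (fun=> x).
Proof. by move=> t; exact: measurable_cst. Qed.

Lemma measurable_rowD X Y : measurable_row X -> measurable_row Y ->
  measurable_row (fun h => X h + Y h).
Proof.
move=> mX mY t; under eq_fun do rewrite mxE; exact: measurable_funD.
Qed.

Lemma measurable_rowZ (a : R) X : measurable_row X -> measurable_row (fun h => a *: X h).
Proof.
move=> mX t; under eq_fun do rewrite mxE; exact: measurable_funM.
Qed.

Lemma measurable_rowN X : measurable_row X -> measurable_row (fun h => - X h).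
Proof.
by move=> mX; under eq_fun do rewrite -scaleN1r; exact: measurable_rowZ.
Qed.

Lemma measurable_rowB X Y : measurable_row X -> measurable_row Y ->
  measurable_row (fun h => X h - Y h).
Proof. by move=> mX mY; apply: measurable_rowD => //; exact: measurable_rowN. Qed.

Lemma measurable_row_sum (I : finType) (X : I -> H -> 'rV[R]_T) :
  (forall i, measurable_row (X i)) -> measurable_row (fun h => \sum_i X i h).
Proof.
move=> mX t; under eq_fun do rewrite summxE.
by apply: measurable_sum => i; exact: mX.
Qed.

Lemma measurable_dot X Y : measurable_row X -> measurable_row Y ->
  measurable_fun setT (fun h => dot (X h) (Y h)).
Proof.
by move=> mX mY; apply: measurable_sum => t; exact: measurable_funM.
Qed.

Lemma measurable_norm2_sq X : measurable_row X ->
  measurable_fun setT (fun h => norm2 (X h) ^+ 2).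
Proof.
by move=> mX; under eq_fun do rewrite norm2_sq; exact: measurable_dot.
Qed.

Lemma measurable_norm2 X : measurable_row X ->
  measurable_fun setT (fun h => norm2 (X h)).
Proof.
move=> mX; rewrite /norm2.
apply: (@measurableT_comp _ _ _ _ _ _ (@Num.sqrt R)).
  exact: continuous_measurable_fun (@sqrt_continuous R).
by apply: measurable_sum => t; exact: (measurable_funX 2).
Qed.

Lemma measurable_costU (m : R) d X : measurable_row X ->
  measurable_fun setT (fun h => costU m d (X h)).
Proof.
move=> mX; rewrite /costU; apply: measurable_funM => //.
apply: measurable_norm2_sq; apply: measurable_rowD; first exact: measurable_row_cst.
exact: measurable_rowZ.
Qed.

(** Round every coordinate to within [e / (T + 1)]. *)
Lemma rational_approximation (x : 'rV[R]_T) (e : R) : 0 < e ->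
  exists q : 'rV[rat]_T, norm2 (x - map_mx ratr q) < e.
Proof.
move=> e0; pose e' := e / (T%:R + 1).
have T0 : 0 < T%:R + 1 :> R by rewrite ltr_wpDl.
have e'0 : 0 < e' by rewrite divr_gt0.
have /choice[q hq] : forall t, exists q : rat, `|x 0 t - ratr q| <= e'.
  move=> t; have /rat_in_itvoo[q] : x 0 t < x 0 t + e' by rewrite ltrDl.
  rewrite in_itv/= => /andP[q1 q2]; exists q.
  by rewrite ler_norml; apply/andP; split; lra.
exists (\row_t q t); apply: (le_lt_trans (norm2_le_sum _)).
apply: (@le_lt_trans _ _ (\sum_(t < T) e')).
  by apply: ler_sum => t _; rewrite !mxE hq.
rewrite sumr_const card_ord -mulr_natr /e' mulrAC ltr_pdivrMr// ltr_pM2l//.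
by rewrite ltrDl.
Qed.

(** A 1-Lipschitz F is the infimum of the functions [F q + norm2 (x - q)] over
    rational q, so its strict sublevel sets are countable unions of balls. *)
Lemma measurable_lipschitz_comp (F : 'rV[R]_T -> R) X :
  (forall x y, `|F x - F y| <= norm2 (x - y)) -> measurable_row X ->
  measurable_fun setT (F \o X).
Proof.
move=> FL mX mT.
apply: (measurability _ (RGenInftyO.measurableE R)) => //= _ [_ [a ->] <-].
rewrite setTI.
pose A n := if unpickle n is Some q then
  [set h | norm2 (X h - map_mx ratr (q : 'rV[rat]_T)) < a - F (map_mx ratr q)]
  else set0.
rewrite (_ : _ @^-1` _ = \bigcup_n A n).
  apply: bigcupT_measurable => n; rewrite /A; case: unpickle => [q|//].
  have mq : measurable_fun setT (fun h => norm2 (X h - map_mx ratr q)).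
    by apply: measurable_norm2; apply: measurable_rowB => //; exact: measurable_row_cst.
  have := mq measurableT _ (measurable_itv `]-oo, (a - F (map_mx ratr q))[).
  rewrite setTI => mpre.
  by rewrite (_ : [set h | _] = (fun h => norm2 (X h - map_mx ratr q)) @^-1`
    `]-oo, (a - F (map_mx ratr q))[%classic).
apply/seteqP; split => h /=; rewrite in_itv/=.
  move=> Fa; have e0 : 0 < (a - F (X h)) / 2 by rewrite divr_gt0// subr_gt0.
  have [q hq] := rational_approximation (X h) e0.
  exists (pickle q) => //; rewrite /A pickleK /=.
  have := FL (X h) (map_mx ratr q); rewrite ler_norml => /andP[h1 h2].
  lra.
move=> [n _]; rewrite /A; case: unpickle => [q|//] /=.
have := FL (X h) (map_mx ratr q); rewrite ler_norml => /andP[h1 h2] h3.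
lra.
Qed.

(** Projections are nonexpansive, so their coordinates are 1-Lipschitz. *)
Lemma measurable_proj (rb : 'rV[R]_T) (E : R) X : admissible rb E ->
  measurable_row X -> measurable_row (fun h => Defs.proj (charging_set rb E) (X h)).
Proof.
move=> adm mX t.
apply: (@measurable_lipschitz_comp
  (fun x => Defs.proj (charging_set rb E) x 0 t)) => // x y.
apply: le_trans (proj_nonexpansive x y adm).
have := coord_le_norm2
  (Defs.proj (charging_set rb E) x - Defs.proj (charging_set rb E) y) t.
by rewrite !mxE.
Qed.

Context {n : nat}.
Variables (rbar : 'I_n -> 'rV[R]_T) (E : 'I_n -> R) (m : R) (d : 'rV[R]_T).
Hypothesis adm : forall i, admissible (rbar i) (E i).
Variables (eta : R) (alpha : nat -> R) (w : H -> nat -> 'rV[R]_T).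
Variable r1 : 'I_n -> 'rV[R]_T.

Lemma measurable_iterate j :
  (forall k, (k <= j)%N -> measurable_row (w ^~ k)) -> forall i,
  measurable_row (fun h => iterate rbar E m d eta alpha (w h) r1 j i).
Proof.
elim: j => [|j IH] mw i; first exact: measurable_row_cst.
under eq_fun do rewrite iterateS.
have {}IH i' := IH (fun k kj => mw k (leqW kj)) i'.
apply: measurable_proj => //; apply: measurable_rowB => //; apply: measurable_rowZ.
apply: measurable_rowD; last first.
  by case: (j.+1 == 1%N); [exact: measurable_row_cst|exact: mw].
rewrite /gradU; apply: measurable_rowZ; apply: measurable_rowD.
  exact: measurable_row_cst.
by apply: measurable_rowZ; exact: measurable_row_sum.
Qed.

Lemma measurable_averaged j :
  (forall k, (k <= j)%N -> measurable_row (w ^~ k)) -> forall i,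
  measurable_row (fun h => averaged rbar E m d eta alpha (w h) r1 j i).
Proof.
elim: j => [|j IH] mw i; first exact: measurable_row_cst.
under eq_fun do rewrite averagedS.
have {}IH := IH (fun k kj => mw k (leqW kj)) i.
by apply: measurable_rowD; apply: measurable_rowZ => //; exact: measurable_iterate.
Qed.

End RowMeasurability.

(** * Independent symmetric noise is orthogonal to the past *)

Section TupleLaws.
Context {R : realType} {dS : measure_display} {S : measurableType dS} {N : nat}.

Definition rectangle (B : nat -> set S) : set (N.-tuple S) :=
  [set h | forall j : 'I_N, B j (tnth h j)].

Lemma measurable_rectangle B : (forall k, measurable (B k)) -> measurable (rectangle B).
Proof.
move=> mB.
rewrite (_ : rectangle B = \bigcap_(j in [set: 'I_N]) ((@tnth N S ^~ j) @^-1` B j)).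
  apply: fin_bigcap_measurable; first exact: finite_finset.
  by move=> j _; rewrite -[_ @^-1` _]setTI; exact: measurable_tnth.
by apply/seteqP; split => [h hB j _|h hB j]; exact: hB.
Qed.

(** Rectangles form a pi-system that generates the product sigma-algebra. *)
Lemma tuple_law_unique (m1 m2 : {measure set (N.-tuple S) -> \bar R}) :
  (m1 setT < +oo)%E ->
  (forall B, (forall k, measurable (B k)) -> m1 (rectangle B) = m2 (rectangle B)) ->
  forall A, measurable A -> m1 A = m2 A.
Proof.
move=> fin m12 A mA.
pose G := [set rectangle B | B in [set B : nat -> set S | forall k, measurable (B k)]].
have GT : G setT.
  by exists (fun=> setT) => //; apply/seteqP; split.
apply: (@measure_unique _ _ _ G (fun=> setT)) => //.
- rewrite eqEsubset; split; last first.
    apply: smallest_sub; first exact: sigma_algebra_measurable.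
    by move=> _ [B mB <-]; exact: measurable_rectangle.
  apply: smallest_sub; first exact: smallest_sigma_algebra.
  rewrite -bigcup_seq => C [i _] [B mB <-]; apply: sub_sigma_algebra.
  exists (fun k : nat => if k == i :> nat then B else setT) => [k|].
    by case: ifP.
  rewrite setTI; apply/seteqP; split => [h /(_ i)|h hB j]; rewrite /= ?eqxx//.
  by case: ifPn => // /eqP/val_inj ->.
- move=> _ _ [B mB <-] [C mC <-]; exists (fun k => B k `&` C k).
    by move=> k; exact: measurableI.
  apply/seteqP; split => [h hBC|h [hB hC] j]; last by split; [exact: hB|exact: hC].
  by split => j; have [] := hBC j.
- by rewrite bigcup_const//; exists 0.
- by move=> _ [B mB <-]; exact: m12.
Qed.

End TupleLaws.

Section NoiseOrthogonality.
Context {R : realType} {T : nat} {disp : measure_display} {Omega : measurableType disp}.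
Variables (P : probability Omega R) (w : nat -> {RV P >-> T.-tuple R}) (N : nat).
Hypothesis indep : mutually_independent [set k | (2 <= k <= N.+1)%N] w.
Hypothesis symm : forall k, (2 <= k <= N.+1)%N -> forall B, measurable B ->
  P (w k @^-1` (tscale (-1) @^-1` B)) = P (w k @^-1` B).

(** Coordinate j carries the noise of round j.+2, the first noisy round being
    round 2. *)
Definition history (omega : Omega) : N.-tuple (T.-tuple R) :=
  [tuple w j.+2 omega | j < N].

Lemma measurable_history : measurable_fun setT history.
Proof.
apply/measurable_fun_tnthP => j.
rewrite (_ : _ \o _ = w j.+2); first exact: measurable_funPT.
by apply/funext => omega /=; rewrite tnth_mktuple.
Qed.

Definition flip (i : 'I_N) (h : N.-tuple (T.-tuple R)) : N.-tuple (T.-tuple R) :=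
  [tuple if j == i then tscale (-1) (tnth h j) else tnth h j | j < N].

Lemma measurable_flip i : measurable_fun setT (flip i).
Proof.
apply/measurable_fun_tnthP => j.
rewrite (_ : _ \o _ = fun h => (if j == i then @tscale R T (-1) else id) (tnth h j)).
  case: (j == i); last exact: measurable_tnth.
  apply: measurableT_comp; [exact: measurable_tscale|exact: measurable_tnth].
by apply/funext => h /=; rewrite tnth_mktuple; case: (j == i).
Qed.

Lemma history_rectangle (B : nat -> set (T.-tuple R)) : (forall k, measurable (B k)) ->
  P (history @^-1` rectangle B)
  = (\prod_(k <- iota 2 N) fine (P (w k @^-1` B k.-2)))%:E.
Proof.
move=> mB.
rewrite -(indep (J := iota 2 N) (B := fun k => B k.-2)) ?iota_uniq//; last first.
  by move=> k /=; rewrite mem_iota add2n ltnS.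
congr (P _); apply/seteqP; split => omega.
  move=> hB [|[|k]]; rewrite /= mem_iota// => /andP[_]; rewrite add2n !ltnS => kN.
  by have := hB (Ordinal kN); rewrite tnth_mktuple.
move=> hB j; rewrite tnth_mktuple; apply: (hB j.+2).
by rewrite /= mem_iota/= add2n !ltnS ltn_ord.
Qed.

(** By independence, probabilities of rectangles are products of marginal ones,
    and the marginal law of coordinate i is symmetric. *)
Lemma history_flip_law i A : measurable A ->
  P (history @^-1` A) = P (history @^-1` (flip i @^-1` A)).
Proof.
have mh := measurable_history.
have mfh : measurable_fun setT (flip i \o history).
  by apply: measurableT_comp => //; exact: measurable_flip.
apply: (@tuple_law_unique R _ _ N (pushforward P history)
  (pushforward P (flip i \o history))).
  by change (P setT < +oo)%E; rewrite probability_setT ltry.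
move=> B mB.
change (P (history @^-1` rectangle B) = P ((flip i \o history) @^-1` rectangle B)).
pose B' (k : nat) := if k == i :> nat then tscale (-1) @^-1` B k else B k.
have mB' k : measurable (B' k).
  rewrite /B'; case: (k == i :> nat) => //.
  by rewrite -[_ @^-1` _]setTI; exact: measurable_tscale.
have -> : (flip i \o history) @^-1` rectangle B = history @^-1` rectangle B'.
  apply/seteqP; split => omega /= hB j; have := hB j;
    by rewrite !tnth_mktuple /B' val_eqE; case: ifP.
rewrite !history_rectangle//; congr (_%:E); apply: eq_big_seq => k.
rewrite mem_iota add2n => kN; rewrite /B'; case: ifP => // _.
by rewrite symm// -ltnS.
Qed.

(** A function of the other noises is unaffected by the sign of noise i, so the
    inner product changes sign under a transformation that preserves the joint
    law. This replaces a conditional expectation given the past. *)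
Lemma noise_orthogonal (i : 'I_N) (V : N.-tuple (T.-tuple R) -> 'rV[R]_T) :
  measurable_row V -> (forall h, V (flip i h) = V h) ->
  P.-integrable setT (EFin \o (fun omega =>
    dot (row_of_tuple (w i.+2 omega)) (V (history omega)))) ->
  (\int[P]_omega (dot (row_of_tuple (w i.+2 omega)) (V (history omega)))%:E = 0)%E.
Proof.
move=> mV Vflip.
pose phi h := (dot (row_of_tuple (tnth h i)) (V h))%:E.
have -> : (EFin \o (fun omega => dot (row_of_tuple (w i.+2 omega)) (V (history omega))))
   = phi \o history.
  by apply/funext => omega; rewrite /phi/= tnth_mktuple.
have -> : (fun omega => (dot (row_of_tuple (w i.+2 omega)) (V (history omega)))%:E)
   = phi \o history.
  by apply/funext => omega; rewrite /phi/= tnth_mktuple.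
move=> intphi.
have mphi : measurable_fun setT phi.
  apply/measurable_EFinP; apply: measurable_dot => // t.
  rewrite (_ : (fun _ => _) = (fun v : T.-tuple R => tnth v t) \o
    (fun h : N.-tuple (T.-tuple R) => tnth h i)).
    by apply: measurableT_comp; exact: measurable_tnth.
  by apply/funext => h; rewrite mxE.
have mh := measurable_history.
have mfh : measurable_fun setT (flip i \o history).
  by apply: measurableT_comp => //; exact: measurable_flip.
have phiN : phi \o (flip i \o history) = (fun omega => - phi (history omega))%E.
  apply/funext => omega /=; rewrite /phi Vflip tnth_mktuple eqxx row_of_tscale.
  by rewrite dotZl mulN1r.
have intphiN : P.-integrable setT (phi \o (flip i \o history)).
  by rewrite phiN; exact: integrableN.
have e1 := integral_pushforward mh mphi intphi measurableT.
have e2 := integral_pushforward mfh mphi intphiN measurableT.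
have e3 : (\int[pushforward P history]_h phi h
   = \int[pushforward P (flip i \o history)]_h phi h)%E.
  by apply: eq_measure_integral => A mA _; exact: (history_flip_law i mA).
have : (\int[P]_omega phi (history omega) = - \int[P]_omega phi (history omega))%E.
  rewrite -integralN; last first.
    exact: integrable_add_def.
  rewrite preimage_setT in e1; rewrite preimage_setT in e2.
  by rewrite -[LHS]e1 e3 e2 phiN.
have := integrable_fin_num measurableT intphi.
rewrite -[X in _ -> X = _ -> _]/(\int[P]_omega (phi \o history) omega)%E.
move: (\int[P]_omega (phi \o history) omega)%E => [r||] //= _ [] rr.
by congr EFin; lra.
Qed.

End NoiseOrthogonality.

(** * Expected suboptimality *)

(** Rounds 1 to j read only the noises of rounds 2 to j. *)
Lemma dpgd_ext {R : realType} {T n : nat} (rbar : 'I_n -> 'rV[R]_T) (E : 'I_n -> R)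
    m d eta alpha (w w' : nat -> 'rV[R]_T) r1 j :
  (forall k, (2 <= k <= j)%N -> w k = w' k) ->
  dpgd rbar E m d eta alpha w r1 j = dpgd rbar E m d eta alpha w' r1 j.
Proof.
elim: j => [//|j IH] ww /=.
rewrite IH => [|k /andP[k2 kj]]; last by rewrite ww// k2 leqW.
case: (dpgd _ _ _ _ _ _ _ _ _) => r rh.
by case: j {IH} ww => [//|j] ww; rewrite (ww j.+2) ?leqnn.
Qed.

Section RealIntegrable.
Context {R : realType} {disp : measure_display} {Omega : measurableType disp}.
Variable P : probability Omega R.
Implicit Types f g : Omega -> R.
Local Notation integrable f := (P.-integrable setT (EFin \o f)).

Lemma integrable_scale f (a : R) : integrable f -> integrable (fun x => a * f x).
Proof. exact: integrableZl. Qed.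

Lemma integrable_add f g :
  integrable f -> integrable g -> integrable (fun x => f x + g x).
Proof. exact: integrableD. Qed.

Lemma integrable_sub f g :
  integrable f -> integrable g -> integrable (fun x => f x - g x).
Proof. exact: integrableB. Qed.

Lemma integrable_const (a : R) : integrable (fun=> a).
Proof. exact: finite_measure_integrable_cst. Qed.

Lemma integral_scale f (a : R) : integrable f ->
  (\int[P]_x (a * f x)%:E = a%:E * \int[P]_x (f x)%:E)%E.
Proof. by move=> fi; rewrite -(integralZl measurableT fi). Qed.

Lemma integral_add f g : integrable f -> integrable g ->
  (\int[P]_x (f x + g x)%:E = \int[P]_x (f x)%:E + \int[P]_x (g x)%:E)%E.
Proof. by move=> fi gi; rewrite -(integralD measurableT fi gi). Qed.

Lemma integral_sub f g : integrable f -> integrable g ->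
  (\int[P]_x (f x - g x)%:E = \int[P]_x (f x)%:E - \int[P]_x (g x)%:E)%E.
Proof. by move=> fi gi; rewrite -(integralB measurableT fi gi). Qed.

Lemma integral_const (a : R) : (\int[P]_x (fun=> a%:E) x = a%:E)%E.
Proof. by have := expectation_cst P a; rewrite unlock. Qed.

End RealIntegrable.

Section ExpectedRegret.
Context {R : realType} {T n : nat}.
Variables (rbar : 'I_n -> 'rV[R]_T) (E : 'I_n -> R) (m : R) (d : 'rV[R]_T).
Hypothesis adm : forall i, admissible (rbar i) (E i).
Variables (eta : R) (alpha : nat -> R) (r1 : 'I_n -> 'rV[R]_T).
Hypothesis eta1 : 1 <= eta.
Variables (c G Dm M : R).
Hypothesis c0 : 0 < c.
Hypothesis alphaE : forall k, alpha k = c / Num.sqrt k%:R.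
Hypothesis gradG : forall r, feasible rbar E r -> norm2 (gradU m d (\sum_i r i)) <= G.
Hypothesis DmP : forall r u, feasible rbar E r -> feasible rbar E u -> sqdist r u <= Dm.
Hypothesis MP : forall r, feasible rbar E r -> norm2 (\sum_i r i) <= M.

Context {disp : measure_display} {Omega : measurableType disp}.
Variables (P : probability Omega R) (w : nat -> {RV P >-> T.-tuple R}) (N : nat).
Hypothesis indep : mutually_independent [set k | (2 <= k <= N.+1)%N] w.
Hypothesis symm : forall k, (2 <= k <= N.+1)%N -> forall B, measurable B ->
  P (w k @^-1` (tscale (-1) @^-1` B)) = P (w k @^-1` B).
Hypothesis second : forall k, (2 <= k <= N.+1)%N ->
  (\int[P]_omega (norm2 (row_of_tuple (w k omega)) ^+ 2)%:E <= (G ^+ 2)%:E)%E.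

(** The noise sequence encoded in a history. The default element of [nth] is
    the zero vector, so that all rounds after the last encoded one, among them
    the fictitious round of the pathwise bound, are noiseless. *)
Definition noise_of (h : N.-tuple (T.-tuple R)) (k : nat) : 'rV[R]_T :=
  if (2 <= k)%N then row_of_tuple (nth [tuple of nseq T 0] h (k - 2)) else 0.

Lemma noise_of_history omega k : (2 <= k <= N.+1)%N ->
  noise_of (history w N omega) k = row_of_tuple (w k omega).
Proof.
case: k => [|[|k]] // /andP[_]; rewrite ltnS => kN.
rewrite /noise_of /= subSS subSS subn0.
by rewrite -(tnth_nth _ (history w N omega) (Ordinal kN)) tnth_mktuple.
Qed.

Lemma noise_of_late h k : (N.+1 < k)%N -> noise_of h k = 0.
Proof.
case: k => [|[|k]] //; rewrite /noise_of /= !ltnS subSS subSS subn0 => Nk.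
rewrite nth_default ?size_tuple//; apply/rowP => t.
by rewrite !mxE (tnth_nth 0) nth_nseq; case: ifP.
Qed.

Lemma measurable_noise_of k : measurable_row (noise_of ^~ k).
Proof.
have [kN|kN] := leqP k N.+1; last first.
  by under eq_fun do rewrite noise_of_late//; exact: measurable_row_cst.
case: k kN => [|[|k]] kN; try exact: measurable_row_cst.
rewrite !ltnS in kN => t.
rewrite (_ : (fun _ => _) = (fun v : T.-tuple R => tnth v t) \o
    (fun h : N.-tuple (T.-tuple R) => tnth h (Ordinal kN))).
  by apply: measurableT_comp; exact: measurable_tnth.
apply/funext => h; rewrite /noise_of /= subSS subSS subn0 mxE.
by rewrite (tnth_nth [tuple of nseq T 0] h).
Qed.

Let W omega := noise_of (history w N omega).

Lemma measurable_noise k : measurable_row (W ^~ k).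
Proof.
move=> t.
apply: (measurableT_comp (measurable_noise_of k t)); exact: measurable_history.
Qed.

Lemma noise_second_moment k :
  (\int[P]_omega (norm2 (W omega k) ^+ 2)%:E <= (G ^+ 2)%:E)%E.
Proof.
have G2 : 0 <= G ^+ 2 by exact: sqr_ge0.
case: (boolP (2 <= k <= N.+1)%N) => kN.
  by under eq_integral do rewrite /W noise_of_history//; exact: second.
rewrite (_ : (fun _ => _) = cst 0%E) ?integral0 ?lee_fin//.
apply/funext => omega /=; rewrite /W.
move: kN; rewrite negb_and -leqNgt -ltnNge => /orP[k1|kN].
  by rewrite /noise_of ltnNge k1 /= norm20 expr0n.
by rewrite noise_of_late// norm20 expr0n.
Qed.

Lemma noise_sq_integrable k :
  P.-integrable setT (EFin \o (fun omega => norm2 (W omega k) ^+ 2)).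
Proof.
apply/integrableP; split.
  by apply/measurable_EFinP; apply: measurable_norm2_sq; exact: measurable_noise.
apply: le_lt_trans (ltry (G ^+ 2)); apply: le_trans (noise_second_moment k).
by under eq_integral do rewrite /= ger0_norm ?sqr_ge0//.
Qed.

Local Notation it w := (iterate rbar E m d eta alpha w r1).

(** The iterate after round i.+1 was computed before the noise of round i.+2 was
    drawn. *)
Lemma sum_iterate_flip (i : 'I_N) h :
  \sum_j it (noise_of (flip i h)) i.+1 j = \sum_j it (noise_of h) i.+1 j.
Proof.
rewrite /iterate (@dpgd_ext _ _ _ _ _ _ _ _ _ (noise_of (flip i h)) (noise_of h))//.
case=> [|[|k]] //=; rewrite !ltnS => ki; rewrite /noise_of /= subSS subSS subn0.
have kN : (k < N)%N by exact: ltn_trans ki (ltn_ord i).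
rewrite -(tnth_nth _ (flip i h) (Ordinal kN)) -(tnth_nth _ h (Ordinal kN)).
by rewrite tnth_mktuple -val_eqE /= ltn_eqF.
Qed.

Section FixedComparator.
Variable u : 'I_n -> 'rV[R]_T.
Hypothesis fu : feasible rbar E u.

Let gap omega k := \sum_i it (W omega) k i - \sum_i u i.

Lemma measurable_gap k : measurable_row (gap ^~ k).
Proof.
apply: measurable_rowB; last exact: measurable_row_cst.
apply: measurable_row_sum => i; apply: measurable_iterate => // j _.
exact: measurable_noise.
Qed.

Lemma gap_bounded omega k : norm2 (gap omega k.+1) <= 2 * M.
Proof.
rewrite (le_trans (norm2D _ _))// norm2N.
by have := MP fu; have := MP (iterate_feasible m d adm eta alpha (W omega) r1 k); lra.
Qed.

(** The gap is bounded and [norm2 w <= 1 + norm2 w ^ 2]. *)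
Lemma noise_dot_integrable k :
  P.-integrable setT (EFin \o (fun omega => dot (W omega k.+2) (gap omega k.+1))).
Proof.
have M0 : 0 <= M by exact: le_trans (norm2_ge0 _) (MP fu).
apply: (@le_integrable _ _ _ _ _ _ _
  (EFin \o (fun omega => (2 * M) * (1 + norm2 (W omega k.+2) ^+ 2)))) => //.
- apply/measurable_EFinP.
  by apply: measurable_dot; [exact: measurable_noise|exact: measurable_gap].
- move=> omega _ /=; rewrite lee_fin (le_trans (normr_dot_le _ _))//.
  rewrite [leRHS]ger0_norm; last by rewrite !mulr_ge0 ?addr_ge0 ?sqr_ge0.
  rewrite mulrC ler_pM ?norm2_ge0 ?gap_bounded//.
  have := sqr_ge0 (norm2 (W omega k.+2) - 1); have := norm2_ge0 (W omega k.+2).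
  have := sqr_ge0 (norm2 (W omega k.+2)); lra.
- apply: integrable_scale; apply: integrable_add; first exact: integrable_const.
  exact: noise_sq_integrable.
Qed.

Lemma noise_dot_mean_zero k :
  (\int[P]_omega (dot (W omega k.+2) (gap omega k.+1))%:E = 0)%E.
Proof.
have [kN|kN] := ltnP k N; last first.
  rewrite (_ : (fun _ => _) = cst 0%E) ?integral0//; apply/funext => omega.
  by rewrite /W noise_of_late ?dot0l// !ltnS.
pose i := Ordinal kN.
pose Vh h := \sum_j it (noise_of h) i.+1 j - \sum_j u j.
have VhE h : Vh (flip i h) = Vh h.
  exact: (f_equal (fun x => x - \sum_j u j) (sum_iterate_flip i h)).
have WE omega : W omega k.+2 = row_of_tuple (w i.+2 omega).
  by rewrite /W noise_of_history//= !ltnS.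
under eq_integral do rewrite WE.
apply: (noise_orthogonal indep symm (i := i) (V := Vh)).
- apply: measurable_rowB; last exact: measurable_row_cst.
  apply: measurable_row_sum => j; apply: measurable_iterate => // l _.
  exact: measurable_noise_of.
- exact: VhE.
- have -> : (fun omega => dot (row_of_tuple (w i.+2 omega)) (Vh (history w N omega)))
      = fun omega => dot (W omega k.+2) (gap omega k.+1).
    by apply/funext => omega; rewrite WE.
  exact: noise_dot_integrable.
Qed.

Let reg omega k := regret_term rbar E m d eta alpha (W omega) r1 c G u k.

(** The inner product averages out, and the expected squared norm of the noise
    is no larger than the squared gradient bound. *)
Lemma regret_term_expectation k :
  P.-integrable setT (EFin \o (fun omega => reg omega k.+1)) /\
  exists2 e : R, (\int[P]_omega (reg omega k.+1)%:E = e%:E)%E &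
    e <= 2 * c * n%:R * G ^+ 2 / Num.sqrt k.+2%:R.
Proof.
pose a := c / Num.sqrt k.+2%:R * n%:R.
have a0 : 0 <= a by rewrite mulr_ge0// divr_ge0// ltW.
have i1 : P.-integrable setT (EFin \o
    (fun omega => a * (G ^+ 2 + norm2 (W omega k.+2) ^+ 2))).
  apply: integrable_scale; apply: integrable_add; first exact: integrable_const.
  exact: noise_sq_integrable.
have i2 := noise_dot_integrable k.
split; first exact: (integrable_sub i1 i2).
have f3 := integrable_fin_num measurableT (noise_sq_integrable k.+2).
have l3 := noise_second_moment k.+2.
exists (a * (G ^+ 2 + fine (\int[P]_omega (norm2 (W omega k.+2) ^+ 2)%:E))).
  rewrite [LHS](integral_sub i1 i2) noise_dot_mean_zero sube0.
  rewrite integral_scale; last first.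
    by apply: integrable_add; [exact: integrable_const|exact: noise_sq_integrable].
  rewrite integral_add; [|exact: integrable_const|exact: noise_sq_integrable].
  by rewrite integral_const [RHS]EFinM [in RHS]EFinD fineK.
have : fine (\int[P]_omega (norm2 (W omega k.+2) ^+ 2)%:E)%E <= G ^+ 2.
  by rewrite -lee_fin fineK.
move=> h; rewrite [leRHS](_ : _ = a * (G ^+ 2 + G ^+ 2)).
  by rewrite ler_wpM2l// lerD2l.
by rewrite /a; ring.
Qed.

Lemma decay_avg_expectation k :
  P.-integrable setT (EFin \o (fun omega => decay_avg eta (reg omega) k)) /\
  (\int[P]_omega (decay_avg eta (reg omega) k)%:E
    <= (2 * (2 * c * n%:R * G ^+ 2) / Num.sqrt k%:R)%:E)%E.
Proof.
have /choice[e he] : forall k, exists e : R,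
    (0 < k)%N -> (\int[P]_omega (reg omega k)%:E = e%:E)%E /\
    e <= 2 * c * n%:R * G ^+ 2 / Num.sqrt k.+1%:R.
  case=> [|j]; first by exists 0.
  by have [_ [e e1 e2]] := regret_term_expectation j; exists e.
suff [ik ->] : P.-integrable setT (EFin \o (fun omega => decay_avg eta (reg omega) k)) /\
    (\int[P]_omega (decay_avg eta (reg omega) k)%:E = (decay_avg eta e k)%:E)%E.
  split => //; rewrite lee_fin; apply: decay_avg_le => //.
    by rewrite mulr_ge0 ?sqr_ge0// !mulr_ge0 ?(ltW c0).
  by move=> j /he[].
elim: k => [|k [ik Ek]].
  split; first exact: integrable0.
  by rewrite integral0.
have [ir _] := regret_term_expectation k; have [Er _] := he k.+1 erefl.
have j1 : P.-integrable setT (EFin \o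
    (fun omega => (1 - theta eta k.+1) * decay_avg eta (reg omega) k)).
  exact: integrable_scale.
have j2 : P.-integrable setT (EFin \o (fun omega => theta eta k.+1 * reg omega k.+1)).
  exact: integrable_scale.
split; first exact: integrable_add.
rewrite [LHS](integral_add j1 j2) !integral_scale//.
by rewrite Ek Er.
Qed.

End FixedComparator.

Lemma feasible_nonempty : exists r, feasible rbar E r.
Proof.
have /choice[r hr] : forall i, exists x, charging_set (rbar i) (E i) x.
  by move=> i; have [x] := charging_set_nonempty (adm i); exists x.
by exists r.
Qed.

Lemma costU_has_inf : has_inf [set costU m d (\sum_i r i) | r in feasible rbar E].
Proof.
split; first by have [r fr] := feasible_nonempty; exists (costU m d (\sum_i r i)), r.
by exists 0 => _ [r _ <-]; rewrite /costU mulr_ge0 ?sqr_ge0.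
Qed.

Local Notation avg omega := (averaged rbar E m d eta alpha (W omega) r1 N.+1).

(** A comparator within e of the infimum is enough, for every e > 0. *)
Lemma expected_suboptimality :
  (\int[P]_omega (costU m d (\sum_i avg omega i) - Ustar rbar E m d)%:E
   <= (2 * (2 * c * n%:R * G ^+ 2) / Num.sqrt N.+1%:R
      + theta eta N.+1 * Num.sqrt N.+2%:R / (2 * c) * Dm)%:E)%E.
Proof.
set b := _ / (2 * c) * Dm; apply/lee_addgt0Pr => e e0.
have [_ [u fu <-] ue] := inf_adherent e0 costU_has_inf.
have [iZ EZ] := decay_avg_expectation fu N.+1.
set Z := (fun omega => decay_avg eta _ _) in iZ EZ.
rewrite -[leRHS]EFinD -addrA EFinD.
apply: (@le_trans _ _ (\int[P]_omega (Z omega + (b + e))%:E)%E); last first.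
  rewrite integral_add//; last exact: integrable_const.
  by rewrite integral_const; apply: leeD.
apply: ge0_le_integral => //.
- move=> omega _; rewrite lee_fin subr_ge0; apply: ge_inf.
    by have [] := costU_has_inf.
  by exists (avg omega) => //; exact: averaged_feasible.
- apply/measurable_EFinP; apply: measurable_funB => //; apply: measurable_costU.
  apply: measurable_row_sum => i; apply: measurable_averaged => // k _.
  exact: measurable_noise.
- have /integrableP[mZ _] : P.-integrable setT (EFin \o (fun omega => Z omega + (b + e))).
    by apply: integrable_add => //; exact: integrable_const.
  exact: mZ.
- move=> omega _; rewrite lee_fin.
  have := pathwise_regret adm (W omega) r1 eta1 c0 alphaE gradG DmP fu (ltn0Sn N).
  rewrite -/b -[decay_avg _ _ _]/(Z omega) => h.
  by rewrite /Ustar; lra.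
Qed.

End ExpectedRegret.

(** * Bounds on the constants of the charging problem *)

Section ProblemConstants.
Context {R : realType} {T n : nat}.
Variables (rbar : 'I_n -> 'rV[R]_T) (E : 'I_n -> R) (m : R) (d : 'rV[R]_T).
Hypothesis adm : forall i, admissible (rbar i) (E i).
Hypothesis m0 : 0 < m.

Local Notation rmax := (rmax rbar E).
Local Notation rho := (rho rbar E).
Local Notation Gmax := (Gmax rbar E m d).

Lemma charging_norm_le (rb x : 'rV[R]_T) (e : R) : charging_set rb e x ->
  norm2 x <= \sum_t rb 0 t.
Proof.
move=> [xb _]; apply: (le_trans (norm2_le_sum x)); apply: ler_sum => t _.
by have /andP[x0 x1] := xb t; rewrite ger0_norm.
Qed.

Lemma norm_le_rmax r i : feasible rbar E r -> norm2 (r i) <= rmax.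
Proof.
move=> fr.
apply: le_trans (le_bigmax 0
  (fun i => sup [set norm2 x | x in charging_set (rbar i) (E i)]) i).
apply: ub_le_sup; last by exists (r i) => //; exact: fr.
by exists (\sum_t rbar i 0 t) => _ [x Cx <-]; exact: charging_norm_le Cx.
Qed.

Lemma rmax_ge0 : 0 <= rmax.
Proof. exact: bigmax_ge_id. Qed.

Lemma sum_sq_le r : feasible rbar E r ->
  \sum_i norm2 (r i) ^+ 2 <= n%:R * rmax ^+ 2.
Proof.
move=> fr; apply: (@le_trans _ _ (\sum_(i < n) rmax ^+ 2)).
  apply: ler_sum => i _.
  have nr := norm_le_rmax i fr.
  by rewrite ler_pXn2r ?nnegrE ?norm2_ge0 ?rmax_ge0.
by rewrite sumr_const card_ord mulr_natl.
Qed.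

Lemma sqrt_sum_sq_le r : feasible rbar E r ->
  Num.sqrt (\sum_i norm2 (r i) ^+ 2) <= Num.sqrt n%:R * rmax.
Proof.
move=> fr; have -> : Num.sqrt n%:R * rmax = Num.sqrt (n%:R * rmax ^+ 2).
  by rewrite sqrtrM// sqrtr_sqr ger0_norm// rmax_ge0.
by rewrite ler_wsqrtr// sum_sq_le.
Qed.

Lemma sum_sq_le_rho r : feasible rbar E r -> \sum_i norm2 (r i) ^+ 2 <= rho ^+ 2.
Proof.
move=> fr; have s0 : 0 <= \sum_i norm2 (r i) ^+ 2.
  by apply: sumr_ge0 => i _; rewrite sqr_ge0.
have h : Num.sqrt (\sum_i norm2 (r i) ^+ 2) <= rho.
  apply: ub_le_sup; last by exists r.
  by exists (Num.sqrt n%:R * rmax) => _ [x fx <-]; exact: sqrt_sum_sq_le.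
rewrite -(sqr_sqrtr s0) ler_pXn2r ?nnegrE ?sqrtr_ge0//.
exact: le_trans (sqrtr_ge0 _) h.
Qed.

Lemma rho_le : rho <= Num.sqrt n%:R * rmax.
Proof.
apply: ge_sup.
  have [r fr] := feasible_nonempty adm.
  by exists (Num.sqrt (\sum_i norm2 (r i) ^+ 2)), r.
by move=> _ [r fr <-]; exact: sqrt_sum_sq_le.
Qed.

(** A profile with positive total is not zero. *)
Lemma rho_gt0 : (0 < n)%N -> 0 < rho.
Proof.
move=> n0; have [r fr] := feasible_nonempty adm; pose i := Ordinal n0.
have r0 : 0 < norm2 (r i).
  rewrite lt_neqAle norm2_ge0 andbT eq_sym; apply/negP => /eqP ri0.
  have [_ sE] := fr i; have [_ E0 _] := adm i.
  move: E0; rewrite -sE big1 ?ltxx// => t _; apply/eqP.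
  by rewrite -normr_le0 -ri0 coord_le_norm2.
have h : 0 < \sum_i norm2 (r i) ^+ 2.
  rewrite (bigD1 i)//= ltr_pwDl ?exprn_gt0//.
  by apply: sumr_ge0 => j _; rewrite sqr_ge0.
have r2 := lt_le_trans h (sum_sq_le_rho fr).
have rr : 0 <= rho.
  apply: le_trans (sqrtr_ge0 (\sum_i norm2 (r i) ^+ 2)) _.
  apply: ub_le_sup; last by exists r.
  by exists (Num.sqrt n%:R * rmax) => _ [x fx <-]; exact: sqrt_sum_sq_le.
rewrite lt_neqAle rr andbT eq_sym; apply: contraTN r2 => /eqP ->.
by rewrite expr0n ltxx.
Qed.

Lemma sqdist_le_rho r u : feasible rbar E r -> feasible rbar E u ->
  sqdist r u <= 4 * rho ^+ 2.
Proof.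
move=> fr fu; have := sum_sq_le_rho fr; have := sum_sq_le_rho fu.
have : sqdist r u <= 2 * (\sum_i norm2 (r i) ^+ 2 + \sum_i norm2 (u i) ^+ 2).
  rewrite -big_split mulr_sumr; apply: ler_sum => i _ /=.
  by rewrite (le_trans (norm2D_sq_le _ _))// norm2N.
lra.
Qed.

Lemma norm_sum_le r : feasible rbar E r -> norm2 (\sum_i r i) <= n%:R * rmax.
Proof.
move=> fr; apply: (@le_trans _ _ (\sum_i norm2 (r i))).
  apply: (big_ind2 (fun x y => norm2 x <= y)) => //; first by rewrite norm20.
  by move=> x a y b xa yb; apply: le_trans (norm2D x y) _; exact: lerD.
apply: (@le_trans _ _ (\sum_(i < n) rmax)).
  by apply: ler_sum => i _; exact: norm_le_rmax.
by rewrite sumr_const card_ord mulr_natl.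
Qed.

Lemma gradU_norm_le r : feasible rbar E r ->
  norm2 (gradU m d (\sum_i r i)) <= m^-1 * (norm2 d + n%:R / m * rmax).
Proof.
move=> fr; have mi : 0 <= m^-1 by rewrite invr_ge0 ltW.
rewrite /gradU norm2Z ger0_norm// ler_wpM2l// (le_trans (norm2D _ _))// lerD2l.
by rewrite norm2Z ger0_norm// mulrAC mulrC ler_wpM2r ?norm_sum_le.
Qed.

Lemma gradU_le_Gmax r : feasible rbar E r -> norm2 (gradU m d (\sum_i r i)) <= Gmax.
Proof.
move=> fr; apply: ub_le_sup; last by exists r.
by exists (m^-1 * (norm2 d + n%:R / m * rmax)) => _ [x fx <-]; exact: gradU_norm_le.
Qed.

Lemma Gmax_le : Gmax <= m^-1 * (norm2 d + n%:R / m * rmax).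
Proof.
apply: ge_sup.
  have [r fr] := feasible_nonempty adm.
  by exists (norm2 (gradU m d (\sum_i r i))), r.
by move=> _ [r fr <-]; exact: gradU_norm_le.
Qed.

End ProblemConstants.

Section PrivacyNoise.
Context {R : realType} {T : nat} {disp : measure_display} {Omega : measurableType disp}.
Variables (P : probability Omega R) (X : {RV P >-> T.-tuple R}) (lam : R).
Hypothesis T0 : (0 < T)%N.
Hypothesis lam0 : 0 < lam.
Hypothesis density : has_density_prop_to X
  (fun v => expR (- (lam * norm2 (row_of_tuple v)))).

Lemma privacy_noise_second_moment :
  (\int[P]_omega (norm2 (row_of_tuple (X omega)) ^+ 2)%:E
   <= (16 * T%:R ^+ 2 / lam ^+ 2)%:E)%E.
Proof.
have [c c0 dX] := density.
have := @exponential_noise_second_moment R T T0 (distribution P X) lam c lam0 c0 dX.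
rewrite ge0_integral_pushforward//.
- by apply/measurable_EFinP; apply: measurable_funX; exact: measurable_norm2_row.
- by move=> v _; rewrite lee_fin sqr_ge0.
Qed.

Lemma privacy_noise_symmetric B : measurable B ->
  P (X @^-1` (tscale (-1) @^-1` B)) = P (X @^-1` B).
Proof.
have [c c0 dX] := density.
exact: (@exponential_noise_symmetric R T (distribution P X) lam c dX).
Qed.

End PrivacyNoise.

(** * The rate *)

Lemma le_fourth_root {R : realType} (a b : R) : 0 <= a -> a ^+ 4 <= b ->
  a <= b `^ 4^-1.
Proof.
move=> a0 ab.
have b0 : 0 <= b by rewrite (le_trans _ ab)// exprn_ge0.
have -> : a = (a ^+ 4) `^ 4^-1.
  by rewrite -powR_mulrn// -powRrM divff ?powRr1// pnatr_eq0.
by apply: ge0_ler_powR; rewrite ?nnegrE ?exprn_ge0// invr_ge0.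
Qed.

Section FinalBound.
Context {R : realType}.
Variables (T n K : nat) (m G Delta eps : R).
Hypothesis T0 : (0 < T)%N.
Hypothesis n0 : (0 < n)%N.
Hypothesis K0 : (0 < K)%N.
Hypothesis m0 : 0 < m.
Hypothesis D0 : 0 < Delta.
Hypothesis e0 : 0 < eps.
Hypothesis KE : K%:R = Num.sqrt (Num.sqrt 2 * G * eps / (3 * T%:R * lipL m * Delta)).

Let Tr : 0 < T%:R :> R. Proof. by rewrite ltr0n. Qed.
Let nr : 0 < n%:R :> R. Proof. by rewrite ltr0n. Qed.
Let Kr : 0 < K%:R :> R. Proof. by rewrite ltr0n. Qed.
Let L0 : 0 < lipL m. Proof. by rewrite /lipL invr_gt0 exprn_gt0. Qed.
Let s2 : 0 < Num.sqrt 2 :> R. Proof. by rewrite sqrtr_gt0. Qed.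
Let s22 : Num.sqrt 2 ^+ 2 = 2 :> R. Proof. by rewrite sqr_sqrtr. Qed.

(** K is positive, so the square root defining it is not taken of a negative
    number. *)
Lemma K_sq : K%:R ^+ 2 = Num.sqrt 2 * G * eps / (3 * T%:R * lipL m * Delta).
Proof.
rewrite KE sqr_sqrtr// ltW//; have := Kr; rewrite KE sqrtr_gt0//.
Qed.

Lemma G_gt0 : 0 < G.
Proof.
have := Kr; rewrite KE sqrtr_gt0 pmulr_lgt0; last first.
  by rewrite invr_gt0 !mulr_gt0.
by rewrite pmulr_lgt0// pmulr_rgt0.
Qed.

(** The choice of K balances the noise against the gradient: it makes the noise
    part of the gradient bound a third of G. *)
Lemma Ghat_noise_part :
  Num.sqrt 2 * T%:R * K%:R ^+ 2 * lipL m * Delta / (2 * eps) = G / 3.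
Proof.
rewrite K_sq.
rewrite [LHS](_ : _ = Num.sqrt 2 ^+ 2 * G / 6); first by rewrite s22; field.
by field; rewrite !gt_eqF.
Qed.

(** With the chosen K, the second moment is at most [8 / 9 * G ^ 2]. *)
Lemma noise_second_moment_le_G lam :
  (1 < K)%N -> lam = 2 * eps / (K%:R * (K%:R - 1) * lipL m * Delta) ->
  0 < lam /\ 16 * T%:R ^+ 2 / lam ^+ 2 <= G ^+ 2.
Proof.
move=> K1 ->; have K1r : 0 < K%:R - 1 :> R by rewrite subr_gt0 ltr1n.
have G0 := G_gt0.
have q0 : 0 < T%:R * lipL m * Delta / eps by rewrite divr_gt0 ?mulr_gt0.
split; first by rewrite divr_gt0 ?mulr_gt0.
have -> : 16 * T%:R ^+ 2 / (2 * eps / (K%:R * (K%:R - 1) * lipL m * Delta)) ^+ 2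
    = (2 * (T%:R * lipL m * Delta / eps) * (K%:R * (K%:R - 1))) ^+ 2.
  by field; rewrite !gt_eqF.
rewrite ler_pXn2r ?nnegrE ?(ltW G0)//; last first.
  by apply: ltW; apply: mulr_gt0; exact: mulr_gt0.
apply: (@le_trans _ _ (2 * (T%:R * lipL m * Delta / eps) * K%:R ^+ 2)).
  apply: ler_wpM2l; first by apply: ltW; exact: mulr_gt0.
  by rewrite expr2 ler_pM2l// gerBl.
rewrite K_sq [leLHS](_ : _ = (2 * Num.sqrt 2 / 3) * G); last first.
  by field; rewrite !gt_eqF.
rewrite ler_piMl ?(ltW G0)// ler_pdivrMr// mul1r.
rewrite -(ler_pXn2r (n := 2)) ?nnegrE ?mulr_ge0 ?(ltW s2)// exprMn s22; lra.
Qed.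

(** With [c = rho / (4 / 3 * sqrt n * G)] both terms are multiples of
    [sqrt n * rho * G / sqrt K]: the first is 3 times it, and the second at most
    [8 * eta] times it, because [theta eta K <= 2 * eta / K]. *)
Lemma suboptimality_rate (eta rho c : R) : 1 <= eta -> 0 < rho ->
  c = rho / (Num.sqrt n%:R * (G + G / 3)) ->
  2 * (2 * c * n%:R * G ^+ 2) / Num.sqrt K%:R
      + theta eta K * Num.sqrt K.+1%:R / (2 * c) * (4 * rho ^+ 2)
  <= 11 * eta * (Num.sqrt n%:R * rho * G / Num.sqrt K%:R).
Proof.
move=> eta1 r0 cE; have G0 := G_gt0.
set s := Num.sqrt n%:R in cE *; have s0 : 0 < s by rewrite sqrtr_gt0.
have sn : n%:R = s ^+ 2 by rewrite sqr_sqrtr// ltW.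
set k := Num.sqrt K%:R; have k0 : 0 < k by rewrite sqrtr_gt0.
have kK : K%:R = k ^+ 2 by rewrite sqr_sqrtr// ltW.
have K1 : 1 <= K%:R :> R by rewrite ler1n.
have thetaK : theta eta K * Num.sqrt K.+1%:R <= 3 * eta / k.
  have sK : Num.sqrt K.+1%:R <= 3 / 2 * k.
    rewrite -(ler_pXn2r (n := 2)) ?nnegrE ?mulr_ge0 ?sqrtr_ge0 ?(ltW k0)//.
    by rewrite sqr_sqrtr// exprMn -kK -natr1; lra.
  have tK : theta eta K <= 2 * eta / k ^+ 2.
    rewrite /theta -kK; apply: ler_pM; rewrite ?invr_ge0; try lra.
    by rewrite lef_pV2 ?posrE; lra.
  apply: (@le_trans _ _ ((2 * eta / k ^+ 2) * (3 / 2 * k))).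
    by apply: ler_pM => //; exact: theta_ge0.
  by rewrite le_eqVlt; apply/orP; left; apply/eqP; field; rewrite gt_eqF.
have -> : 2 * (2 * c * n%:R * G ^+ 2) / k = 3 * (s * rho * G / k).
  by rewrite cE sn; field; rewrite !gt_eqF//; lra.
have -> : theta eta K * Num.sqrt K.+1%:R / (2 * c) * (4 * rho ^+ 2)
    = (theta eta K * Num.sqrt K.+1%:R) * (8 / 3 * (s * rho * G)).
  by rewrite cE; field; rewrite !gt_eqF//; lra.
have p0 : 0 < s * rho * G by rewrite !mulr_gt0.
have h : theta eta K * Num.sqrt K.+1%:R * (8 / 3 * (s * rho * G)) <=
    3 * eta / k * (8 / 3 * (s * rho * G)).
  by rewrite ler_pM2r// mulr_gt0.
have q0 : 0 < s * rho * G / k by rewrite divr_gt0.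
have h2 : s * rho * G / k <= eta * (s * rho * G / k) by rewrite ler_peMl// ltW.
lra.
Qed.

(** Compare fourth powers: [K ^ 2] is proportional to [G * m ^ 2], so the left
    side contributes [n ^ 4 * G ^ 3 / m ^ 2], and [G <= H / m] leaves
    [n ^ 4 / m ^ 5], which is [(n / m) ^ 5 / n]. *)
Lemma rate_fourth_root (gamma H : R) : n%:R / m = gamma -> 0 <= H -> G <= m^-1 * H ->
  n%:R * G / Num.sqrt K%:R <=
  (3 * gamma ^+ 5 * H ^+ 3) `^ 4^-1 * (T%:R `^ 4^-1 * (Delta / (n%:R * eps)) `^ 4^-1).
Proof.
move=> <- H0 GH; have G0 := G_gt0.
have g0 : 0 < n%:R / m by rewrite divr_gt0.
have x0 : 0 <= 3 * (n%:R / m) ^+ 5 * H ^+ 3.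
  by apply: mulr_ge0; [apply: mulr_ge0 => //; exact/exprn_ge0/ltW|exact: exprn_ge0].
have y0 : 0 <= Delta / (n%:R * eps) 
  by apply: divr_ge0; [exact: ltW|apply: mulr_ge0; exact: ltW].
rewrite -(powRM _ (ltW Tr) y0) -(powRM _ x0 (mulr_ge0 (ltW Tr) y0)).
apply: le_fourth_root; first by rewrite divr_ge0 ?mulr_ge0 ?sqrtr_ge0// ltW.
have k4 : Num.sqrt K%:R ^+ 4 = K%:R ^+ 2 :> R.
  by rewrite -[4%N]/(2 * 2)%N exprM sqr_sqrtr// ltW.
rewrite expr_div_n k4 K_sq /lipL.
rewrite [leLHS](_ : _ = (G * m) ^+ 3 * (3 / Num.sqrt 2 * ((n%:R / m) ^+ 5 *
  (T%:R * (Delta / (n%:R * eps)))))); last by field; rewrite !gt_eqF.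
rewrite [leRHS](_ : _ = H ^+ 3 * (3 * ((n%:R / m) ^+ 5 *
  (T%:R * (Delta / (n%:R * eps)))))); last by ring.
have z0 : 0 < (n%:R / m) ^+ 5 * (T%:R * (Delta / (n%:R * eps))).
  by rewrite !(mulr_gt0, exprn_gt0, invr_gt0).
apply: ler_pM.
- by rewrite exprn_ge0// mulr_ge0// ltW.
- by rewrite mulr_ge0 ?(ltW z0)// divr_ge0// ltW.
- rewrite ler_pXn2r ?nnegrE ?mulr_ge0 ?(ltW G0) ?(ltW m0)//.
  by rewrite -ler_pdivlMr// mulrC.
rewrite ler_pM2r// ler_pdivrMr// ler_peMr//.
rewrite -(ler_pXn2r (n := 2)) ?nnegrE ?(ltW s2)// s22; lra.
Qed.

End FinalBound.

Theorem corollary9 (R : realType) :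
  exists C : R -> R -> R -> R,
  forall (T n : nat) (m gamma : R) (d : 'rV[R]_T)
    (rbar : 'I_n -> 'rV[R]_T) (E : 'I_n -> R) (dr dE eps eta : R) (K : nat)
    (r1 : 'I_n -> 'rV[R]_T)
    (disp : measure_display) (Omega : measurableType disp)
    (P : probability Omega R) (w : nat -> {RV P >-> T.-tuple R}),
  (0 < T)%N -> (0 < n)%N -> 0 < m -> n%:R / m = gamma ->
  (forall i, admissible (rbar i) (E i)) ->
  0 <= dr -> 0 <= dE -> 0 < Delta rbar E dr dE -> 0 < eps -> 1 <= eta ->
  (0 < K)%N ->
  K%:R = Num.sqrt (Num.sqrt 2 * Gmax rbar E m d * eps
                   / (3 * T%:R * lipL m * Delta rbar E dr dE)) ->
  privacy_noise m eps (Delta rbar E dr dE) K w ->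
  let rhat (omega : Omega) : 'I_n -> 'rV[R]_T :=
    dpgd_output rbar E m d eta (stepsize rbar E m d dr dE eps K)
      (fun k => row_of_tuple (w k omega)) r1 K in
  ('E_P[fun omega => (costU m d (\sum_i rhat omega i) - Ustar rbar E m d)%R]
   <= (C (norm2 d) gamma (rmax rbar E)
       * (eta * T%:R `^ (4^-1)
          * (Delta rbar E dr dE / (n%:R * eps)) `^ (4^-1)))%R%:E)%E.
Proof.
exists (fun dn g r => 11 * r * (3 * g ^+ 5 * (dn + g * r) ^+ 3) `^ 4^-1).
move=> T n m gamma d rbar E dr dE eps eta K r1 disp Omega P w T0 n0 m0 gE adm _ _.
set D := Delta _ _ _ _ => D0 e0 eta1 K0 KE [indep dens].
cbv zeta.
set G := Gmax rbar E m d in KE.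
have G0 : 0 < G by exact: G_gt0 T0 K0 m0 D0 e0 KE.
case: K K0 KE indep dens => // N K0 KE indep dens.
have rho0 := rho_gt0 adm n0.
pose c := rho rbar E / (Num.sqrt n%:R * (G + G / 3)).
have nr : 0 < n%:R :> R by rewrite ltr0n.
have c0 : 0 < c by rewrite divr_gt0// mulr_gt0 ?sqrtr_gt0// addr_gt0// divr_gt0.
have alphaE k : stepsize rbar E m d dr dE eps N.+1 k = c / Num.sqrt k%:R.
  by rewrite /stepsize /Ghat -/D -/G (Ghat_noise_part T0 K0 m0 D0 e0 KE).
have density k : (2 <= k <= N.+1)%N -> exists2 lam, 0 < lam /\
    16 * T%:R ^+ 2 / lam ^+ 2 <= G ^+ 2 &
    has_density_prop_to (w k) (fun v => expR (- (lam * norm2 (row_of_tuple v)))).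
  move=> kN; exists (2 * eps / (N.+1%:R * (N.+1%:R - 1) * lipL m * D)).
    apply: (noise_second_moment_le_G T0 K0 m0 D0 e0 KE) => //.
    by case/andP: kN => k2 /(leq_trans k2).
  have := dens k kN; congr has_density_prop_to; apply/funext => v.
  by rewrite mulrAC.
have symm k : (2 <= k <= N.+1)%N -> forall B, measurable B ->
    P (w k @^-1` (tscale (-1) @^-1` B)) = P (w k @^-1` B).
  by move=> /density[lam _ dk] B; exact: privacy_noise_symmetric dk B.
have second k : (2 <= k <= N.+1)%N ->
    (\int[P]_omega (norm2 (row_of_tuple (w k omega)) ^+ 2)%:E <= (G ^+ 2)%:E)%E.
  move=> /density[lam [lam0 lamG] dk].
  by apply: le_trans (privacy_noise_second_moment T0 lam0 dk) _; rewrite lee_fin.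
have main := @expected_suboptimality R T n rbar E m d adm eta
  (stepsize rbar E m d dr dE eps N.+1) r1 eta1 c G _ _ c0 alphaE
  (fun r fr => gradU_le_Gmax d m0 fr) (fun r u fr fu => sqdist_le_rho fr fu)
  (fun r fr => norm_sum_le fr) disp Omega P w N indep symm second.
rewrite unlock.
under eq_integral.
  move=> omega _; rewrite /dpgd_output.
  rewrite (@dpgd_ext _ _ _ _ _ _ _ _ _ _ (noise_of (history w N omega))); last first.
    by move=> k kN; rewrite noise_of_history.
  over.
apply: (le_trans main); rewrite lee_fin.
apply: (le_trans (suboptimality_rate T0 n0 K0 m0 D0 e0 KE eta1 rho0 erefl)).
set k := Num.sqrt N.+1%:R.
have k0 : 0 < k by rewrite sqrtr_gt0 ltr0n.
set r := rmax rbar E; have r0 : 0 <= r by exact: rmax_ge0.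
have H0 : 0 <= norm2 d + gamma * r.
  by rewrite addr_ge0 ?norm2_ge0// mulr_ge0// -gE divr_ge0 ?ltW.
have GH : G <= m^-1 * (norm2 d + gamma * r) by rewrite -gE; exact: Gmax_le.
have rate := rate_fourth_root T0 n0 K0 m0 D0 e0 KE gE H0 GH.
apply: (@le_trans _ _ (11 * eta * (r * (n%:R * G / k)))).
  rewrite ler_wpM2l//; first by rewrite mulr_ge0//; lra.
  have -> : r * (n%:R * G / k) = Num.sqrt n%:R * (Num.sqrt n%:R * r) * G / k.
    by rewrite -[in LHS](sqr_sqrtr (ltW nr)); ring.
  rewrite ler_wpM2r ?invr_ge0 ?(ltW k0)// ler_wpM2r ?(ltW G0)//.
  by rewrite ler_wpM2l ?sqrtr_ge0// rho_le.
rewrite [leRHS](_ : _ = 11 * eta *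
  (r * ((3 * gamma ^+ 5 * (norm2 d + gamma * r) ^+ 3) `^ 4^-1 *
    (T%:R `^ 4^-1 * (D / (n%:R * eps)) `^ 4^-1)))); last by ring.
rewrite ler_wpM2l//; first by rewrite mulr_ge0//; lra.
by rewrite ler_wpM2l.
Qed.
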